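(* Given an acyclic digraph $G$ on $n$ vertices and two positive integers $k,\ell$, one can decide in time $O(\ell^k\cdot n^{2k+1})$ whether $G$ contains a subdivision of a $(k\times \ell)$-spindle.
   Context: Digraphs are finite and may have multiple arcs. A $(k\times\ell)$-spindle is a digraph consisting of $k$ directed paths from a vertex $u$ to a vertex $v\ne u$, each with exactly $\ell$ arcs, pairwise sharing only the vertices $u$ and $v$. A subdivision of a digraph $F$ is obtained by replacing each arc $(a,b)$ by a directed $(a,b)$-path with new internal vertices; $G$ contains a subdivision of $F$ if some subdigraph of $G$ is isomorphic to a subdivision of $F$. *)

(* Defs.v *)
From mathcomp Require Import all_boot.

Set Implicit Arguments.
Unset Strict Implicit.
Unset Printing Implicit Defensive.

(* Arcs are first-class objects, so parallel arcs are allowed.  Loops are not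
   excluded here; [acyclic] rules them out. *)
Record digraph := Digraph {
  vertices : finType;
  arcs : finType;
  source : arcs -> vertices;
  target : arcs -> vertices }.

Definition multiplicity (G : digraph) (x y : vertices G) : nat :=
  #|[set a : arcs G | (source a == x) && (target a == y)]|.

Definition adjacent (G : digraph) : rel (vertices G) :=
  fun x y => 0 < multiplicity x y.

Definition acyclic (G : digraph) : Prop :=
  forall c : seq (vertices G), ucycle (@adjacent G) c -> c = [::].

Definition isomorphic (G H : digraph) : Prop :=
  exists (phi : vertices G -> vertices H) (psi : arcs G -> arcs H),
    [/\ bijective phi, bijective psi,
        forall a, source (psi a) = phi (source a) &
        forall a, target (psi a) = phi (target a)].

Record subdigraph (G : digraph) := Subdigraph {
  sub_vertices : {set vertices G};
  sub_arcs : {set arcs G};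
  sub_source : forall a, a \in sub_arcs -> source a \in sub_vertices;
  sub_target : forall a, a \in sub_arcs -> target a \in sub_vertices }.

Definition digraph_of_subdigraph (G : digraph) (H : subdigraph G) : digraph :=
  @Digraph {x : vertices G | x \in sub_vertices H}
           {a : arcs G | a \in sub_arcs H}
           (fun a => exist _ (source (val a)) (sub_source (valP a)))
           (fun a => exist _ (target (val a)) (sub_target (valP a))).

Coercion digraph_of_subdigraph : subdigraph >-> digraph.

(* The arc [e] of [F] is replaced by a directed path with [s e] new internal
   vertices, hence [(s e).+1] arcs; [s e = 0] keeps the arc.  Counting from 0, the [i]-th arc of
   this path leaves the [(i - 1)]-th internal vertex (the source of [e] if
   [i = 0]) and enters the [i]-th one (the target of [e] if [i = s e]). *)
Section Subdivision.
Variables (F : digraph) (s : arcs F -> nat).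

Definition subdivision_vertex : finType :=
  (vertices F + {e : arcs F & 'I_(s e)})%type.

Definition subdivision_arc : finType := {e : arcs F & 'I_(s e).+1}.

Definition subdivision_source (a : subdivision_arc) : subdivision_vertex :=
  if unlift ord0 (tagged a) is Some j
  then inr (Tagged (fun e => 'I_(s e)) j) else inl (source (tag a)).

Definition subdivision_target (a : subdivision_arc) : subdivision_vertex :=
  if unlift ord_max (tagged a) is Some j
  then inr (Tagged (fun e => 'I_(s e)) j) else inl (target (tag a)).

Definition subdivision : digraph :=
  Digraph subdivision_source subdivision_target.

End Subdivision.

Definition contains_subdivision (G F : digraph) : Prop :=
  exists (s : arcs F -> nat) (H : subdigraph G), isomorphic H (subdivision s).

(* For [0 < l].  The end-vertices u and v are [inl false] and [inl true];
   [inr (i, j)] is the [j]-th internal vertex of the [i]-th path and [(i, j)]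
   the [j]-th arc of that path. *)
Section Spindle.
Variables k l : nat.

Definition spindle_vertex : finType := (bool + 'I_k * 'I_l.-1)%type.

Definition spindle_arc : finType := ('I_k * 'I_l.-1.+1)%type.

Definition spindle_source (a : spindle_arc) : spindle_vertex :=
  if unlift ord0 a.2 is Some j then inr (a.1, j) else inl false.

Definition spindle_target (a : spindle_arc) : spindle_vertex :=
  if unlift ord_max a.2 is Some j then inr (a.1, j) else inl true.

Definition spindle : digraph := Digraph spindle_source spindle_target.

End Spindle.

(* Running time is measured on a unit-cost random access machine: registers and
   memory cells hold natural numbers, and memory is addressed through registers.
   Addition and truncated subtraction are the only arithmetic operations; in
   particular there is no unit-cost multiplication. *)
Inductive instruction :=
  | Const (d c : nat)     (* R[d] := c *)
  | Add (d a b : nat)     (* R[d] := R[a] + R[b] *)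
  | Sub (d a b : nat)     (* R[d] := R[a] - R[b], truncated at 0 *)
  | Read (d a : nat)      (* R[d] := M[R[a]] *)
  | Write (a b : nat)     (* M[R[a]] := R[b] *)
  | JumpLt (a b q : nat). (* if R[a] < R[b], continue at instruction q *)

Definition program := seq instruction.

Record state := State {
  counter : nat;
  register : nat -> nat;
  memory : nat -> nat }.

Definition update (g : nat -> nat) (i x : nat) : nat -> nat :=
  fun j => if j == i then x else g j.

Definition execute (c : instruction) (s : state) : state :=
  let: State q R M := s in
  match c with
  | Const d x => State q.+1 (update R d x) M
  | Add d a b => State q.+1 (update R d (R a + R b)) M
  | Sub d a b => State q.+1 (update R d (R a - R b)) M
  | Read d a => State q.+1 (update R d (M (R a))) M
  | Write a b => State q.+1 R (update M (R a) (R b))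
  | JumpLt a b q' => State (if R a < R b then q' else q.+1) R M
  end.

(* The machine halts by leaving the program; a halted state is a fixed point of
   [step]. *)
Definition halted (p : program) (s : state) : bool := size p <= counter s.

Definition step (p : program) (s : state) : state :=
  if onth p (counter s) is Some c then execute c s else s.

Definition run (p : program) (t : nat) (s : state) : state := iter t (step p) s.

Definition accepting (s : state) : bool := register s 0 != 0.

Definition initial (args data : seq nat) : state :=
  State 0 (nth 0 args) (nth 0 data).

(* The adjacency matrix, with arc multiplicities as entries and in row-major
   order, of [G] with its vertices numbered by [f].  Its size depends only on
   the number of vertices, not on the number of parallel arcs. *)
Definition adjacency_matrix (n : nat) (G : digraph) (f : 'I_n -> vertices G) :
    seq nat :=
  [seq multiplicity (f i) (f j) | i <- enum 'I_n, j <- enum 'I_n].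

(* Main.v *)
Require Import Defs.
From mathcomp Require Import all_boot.
From mathcomp Require Import zify.

Set Implicit Arguments.
Unset Strict Implicit.
Unset Printing Implicit Defensive.

(* For an end-vertex [v], the [k] paths to [v] are traced by [k] tokens, each
   with a counter below [l] of the internal vertices it has yet to visit.  The
   token moved is always one standing earliest in a topological order, so no
   other token can reach the vertex it leaves: the traced paths are disjoint as
   soon as no move enters an occupied vertex other than [v].  Whether all
   tokens can get to [v] thus depends only on the current state, one of [(n l)^k]
   pairs of positions and counters, and a move increases the number
   [sum_j (p_j l + c_j) (n l)^j] of the state.  A table filled downwards over
   these numbers, with at most [n] moves per state and [O(k)] work per move, takes
   time [O(n^(k+2) l^k k)] over all [v], and [k <= n^(k-1)] for [n >= 2].
   Parallel arcs matter only for direct arcs from the start to [v]; these are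
   counted at the moment when a token uses one.

   The algorithm is a structured program with bounded loops, translated to the
   random access machine instruction by instruction; its running time is bounded
   through its loop bounds alone. *)

(** * Disjoint paths and subdivisions of spindles *)

(** Since an arc may be subdivided at will, a path of the subdivided spindle is only required to
    have length at least [l]; this is why counters are truncated at 0 and never force a token to
    arrive. An arc that touches an internal vertex of a path is determined by the vertices of that
    path, so only direct arcs can compete for parallel copies. Counting them costs no extra state:
    the paths may be renumbered with the direct ones last, and ties between tokens at one vertex are
    broken by the least index. When the first direct move is made, the tokens still at the start
    vertex are then exactly those that need an arc of their own. The machine has no multiplication,
    so row offsets and powers of the base are tabulated by repeated addition. The number of a
    successor state is updated incrementally along the loop over moves, and the current state is
    kept digit by digit and counted down like an odometer instead of being decoded from its number.
    With one vertex [k] is not bounded by a power of [n], and even one loop over the tokens would be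
    too slow when [l = 1]; fewer than two vertices are therefore rejected at once. *)

Definition embeds (F G : digraph) : Prop :=
  exists (phi : vertices F -> vertices G) (psi : arcs F -> arcs G),
    [/\ injective phi, injective psi,
        forall a, source (psi a) = phi (source a) &
        forall a, target (psi a) = phi (target a)].

(** The bijection goes from the image back to the domain, the direction in which
    [contains_subdivision] wants its isomorphism. *)
Lemma imset_bijection (S T : finType) (g : S -> T) :
  injective g ->
  exists2 h : {x : T | x \in [set g x | x in S]} -> S,
    bijective h & forall x, g (h x) = val x.
Proof.
move=> g_inj.
have mem x : g x \in [set g x | x in S] by apply: imset_f.
pose g' x : {x : T | x \in [set g x | x in S]} := exist _ (g x) (mem x).
have g'_inj : injective g' by move=> x y [/g_inj].
have [|h hK Kh] := inj_card_bij g'_inj; first by rewrite card_sig card_imset.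
by exists h => [|x]; [exists g' | rewrite -[g _]/(val (g' (h x))) Kh].
Qed.

(** The image of an embedding is a subdigraph, and an inverse isomorphism followed by the inclusion
    is an embedding. This removes the sigma types from all later arguments. *)
Lemma contains_subdivision_embeds (G F : digraph) :
  contains_subdivision G F <-> exists s : arcs F -> nat, embeds (subdivision s) G.
Proof.
split=> [[s [H [phi [psi [[phi' phiK Kphi] [psi' psiK Kpsi] hs ht]]]]]|].
  exists s, (val \o phi'), (val \o psi'); split.
  - exact: inj_comp val_inj (can_inj Kphi).
  - exact: inj_comp val_inj (can_inj Kpsi).
  - by move=> a; have := congr1 (val \o phi') (hs (psi' a)); rewrite /= Kpsi phiK => ->.
  - by move=> a; have := congr1 (val \o phi') (ht (psi' a)); rewrite /= Kpsi phiK => ->.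
move=> [s [phi [psi [phi_inj psi_inj hs ht]]]].
have [h h_bij hK] := imset_bijection phi_inj.
have [g g_bij gK] := imset_bijection psi_inj.
have subs a : a \in [set psi x | x : arcs (subdivision s)] ->
    source a \in [set phi x | x : vertices (subdivision s)].
  by move=> /imsetP[b _ ->]; rewrite hs imset_f.
have subt a : a \in [set psi x | x : arcs (subdivision s)] ->
    target a \in [set phi x | x : vertices (subdivision s)].
  by move=> /imsetP[b _ ->]; rewrite ht imset_f.
exists s, (Subdigraph subs subt), h, g; split=> // a.
  by apply: phi_inj; rewrite hK /= -hs gK.
by apply: phi_inj; rewrite hK /= -ht gK.
Qed.

(* The last condition accounts for parallel arcs: each path of length one needs
   its own arc from [u] to [v]. *)
Definition linkage (G : digraph) (k l : nat) (u v : vertices G)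
    (q : 'I_k -> seq (vertices G)) : Prop :=
  [/\ forall i, path (@adjacent G) u (q i) /\ last u (q i) = v,
      forall i, l <= size (q i),
      forall i j x, i != j -> x \in q i -> x \in u :: q j -> x = v &
      #|[set i | size (q i) == 1]| <= multiplicity u v].

Lemma adjacent_arc (G : digraph) (a : arcs G) : adjacent (source a) (target a).
Proof. by rewrite /adjacent /multiplicity (cardD1 a) inE !eqxx. Qed.

(** The [y j] are waypoints. The lemma serves both for the single steps inside a subdivided arc and
    for joining the subdivided arcs of one spindle path. *)
Lemma flatten_path (T : eqType) (e : rel T) (y : nat -> T) (t : nat -> seq T) m :
  (forall j, j < m -> path e (y j) (t j) /\ last (y j) (t j) = y j.+1) ->
  path e (y 0) (flatten [seq t j | j <- iota 0 m]) /\
  last (y 0) (flatten [seq t j | j <- iota 0 m]) = y m.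
Proof.
elim: m => [//|m IH] h; have [|p1 p2] := IH; first by move=> j /ltnW; apply: h.
rewrite -addn1 iotaD map_cat flatten_cat cat_path last_cat /= cats0 p1 p2 addn1.
exact: h.
Qed.

Lemma inord_lift_max m r (h : r < m) : inord r = lift ord_max (Ordinal h).
Proof. by apply: ord_inj; rewrite lift_max inordK // ltnW. Qed.

Lemma inord_lift0 m r (h : r < m) : inord r.+1 = lift ord0 (Ordinal h).
Proof. by apply: ord_inj; rewrite lift0 inordK. Qed.

Lemma inord_ord0 m : inord 0 = ord0 :> 'I_m.+1.
Proof. by apply: ord_inj; rewrite inordK. Qed.

Lemma inord_ord_max m : inord m = ord_max :> 'I_m.+1.
Proof. by apply: ord_inj; rewrite inordK. Qed.

Section SubdivisionPath.
Variables (F : digraph) (s : arcs F -> nat).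
Implicit Types (e : arcs F).

Let T := subdivision_vertex s.
Let sub_arc e r : subdivision_arc s := existT (fun e => 'I_(s e).+1) e (inord r).
Definition arc_path e : seq T :=
  [seq subdivision_target (sub_arc e r) | r <- iota 0 (s e).+1].

Definition has_arc (G : digraph) (x y : vertices G) : bool :=
  [exists a : arcs G, (source a == x) && (target a == y)].

Lemma arc_path_path e :
  path (@has_arc (subdivision s)) (inl (source e)) (arc_path e) /\
  last (inl (source e)) (arc_path e) = inl (target e).
Proof.
pose y r : T := if r is r'.+1 then subdivision_target (sub_arc e r') else inl (source e).
have ysrc r : r < (s e).+1 -> subdivision_source (sub_arc e r) = y r.
  case: r => [|r] hr; rewrite /subdivision_source /sub_arc /=.
    by rewrite inord_ord0 unlift_none.
  have hr' : r < s e := hr.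
  (* Arc [r.+1] leaves the internal vertex that arc [r] enters: [unlift ord0] of the one index and
     [unlift ord_max] of the other both give [r]. *)
  rewrite /subdivision_target /= (inord_lift0 hr') (inord_lift_max hr').
  by rewrite !liftK.
have := @flatten_path _ (@has_arc (subdivision s)) y (fun r => [:: y r.+1]) (s e).+1.
have -> : flatten [seq [:: y r.+1] | r <- iota 0 (s e).+1] = arc_path e.
  by rewrite /arc_path; elim: (iota _ _) => //= r l ->.
case=> [j hj|-> ->].
  split=> //=; rewrite andbT; apply/existsP; exists (sub_arc e j).
  by rewrite /= ysrc // !eqxx.
split=> //; rewrite /y /subdivision_target /= inord_ord_max.
by rewrite unlift_none.
Qed.

Lemma mem_arc_path e x : x \in arc_path e ->
  x = inl (target e) \/ exists r, x = inr (Tagged (fun e => 'I_(s e)) (r : 'I_(s e))).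
Proof.
move=> /mapP[r _ ->]; rewrite /subdivision_target /sub_arc /=.
by case: unliftP => [r' _|_]; [right; exists r' | left].
Qed.

Lemma size_arc_path e : size (arc_path e) = (s e).+1.
Proof. by rewrite size_map size_iota. Qed.

End SubdivisionPath.

Lemma embeds_path (F G : digraph) (phi : vertices F -> vertices G) psi x p :
  (forall a, source (psi a) = phi (source a)) ->
  (forall a, target (psi a) = phi (target a)) ->
  path (@has_arc F) x p -> path (@adjacent G) (phi x) (map phi p).
Proof.
move=> hs ht; elim: p x => //= y p IH x /andP[/existsP[a /andP[/eqP <- /eqP ay]]] hp.
by rewrite IH // -ay -hs -ht adjacent_arc.
Qed.

(** The subdivided arcs of each spindle path are joined. A joined path of length one forces [l = 1]
    and an arc that is kept, so its image runs from [u] to [v]; injectivity of [psi] on these arcs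
    gives the bound by the multiplicity. *)
Lemma linkage_of_embedding (G : digraph) (k l : nat) (s : arcs (spindle k l) -> nat) :
  0 < l -> embeds (subdivision s) G ->
  exists u v (q : 'I_k -> seq (vertices G)), u != v /\ linkage l u v q.
Proof.
move=> l_gt0 [phi [psi [phi_inj psi_inj hs ht]]].
pose U : vertices (subdivision s) := inl (inl false).
pose W : vertices (subdivision s) := inl (inl true).
pose A (i : 'I_k) j : arcs (spindle k l) := (i, inord j).
pose Q i := flatten [seq arc_path s (A i j) | j <- iota 0 l].
have Q_path i : path (@has_arc (subdivision s)) U (Q i) /\ last U (Q i) = W.
  pose y j : vertices (subdivision s) :=
    inl (if j is j'.+1 then spindle_target (A i j') else inl false).
  have ysrc j : j < l -> inl (spindle_source (A i j)) = y j.
    case: j => [|j] hj; rewrite /spindle_source /=.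
      by rewrite inord_ord0 unlift_none.
    have hj' : j < l.-1 by lia.
    rewrite /y /spindle_target /= (inord_lift0 hj') (inord_lift_max hj').
    by rewrite !liftK.
  have := @flatten_path _ (@has_arc (subdivision s)) y (fun j => arc_path s (A i j)) l.
  case=> [j hj|p1 p2]; first by rewrite -ysrc //; apply: arc_path_path.
  have yl m : 0 < m -> y m = inl (spindle_target (A i m.-1)) by case: m.
  split=> //; rewrite [LHS]p2 yl // /spindle_target /=.
  by rewrite inord_ord_max unlift_none.
have size_Q i : size (Q i) = \sum_(j <- iota 0 l) (s (A i j)).+1.
  rewrite /Q size_flatten /shape -map_comp sumnE big_map.
  by apply: eq_bigr => j _; exact: size_arc_path.
have mem_Q i x : x \in Q i -> x = W \/
    (exists j, x = inl (inr (i, j))) \/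
    exists j r, x = inr (existT (fun e => 'I_(s e)) (i, j) r).
  move=> /flattenP[t /mapP[j _ ->]] /mem_arc_path [->|[r ->]].
    rewrite /target /= /spindle_target /=.
    by case: unliftP => [j' _|_]; [right; left; exists j' | left].
  by right; right; exists (inord j), r.
exists (phi U), (phi W), (fun i => map phi (Q i)); split; first by rewrite (inj_eq phi_inj).
split.
- move=> i; have [p1 p2] := Q_path i; rewrite last_map p2; split=> //.
  exact: embeds_path p1.
- move=> i; rewrite size_map size_Q.
  rewrite -[X in X <= _](size_iota 0 l) -sum1_size leq_sum //.
- move=> i j x nij /mapP[y yi ->]; rewrite -map_cons (mem_map phi_inj) => yj.
  congr phi; move: yj; rewrite inE => /orP[/eqP yU|yj].
    by move: yi; rewrite yU => /mem_Q [//|[[? //]|[? [? //]]]].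
  move: (mem_Q _ _ yi) (mem_Q _ _ yj) => [//|[[j1 ->]|[j1 [r1 ->]]]].
    by move=> [//|[[j2 [e]]|[j2 [r2 //]]]]; rewrite e eqxx in nij.
  by move=> [//|[[j2 //]|[j2 [r2 [e _]]]]]; rewrite e eqxx in nij.
- pose a i : arcs (subdivision s) := existT (fun e => 'I_(s e).+1) (A i 0) ord0.
  have a_inj : injective (psi \o a) by apply: inj_comp psi_inj _ => i j [].
  rewrite -(card_imset _ a_inj); apply: subset_leq_card; apply/subsetP => b.
  move=> /imsetP[i]; rewrite inE (size_map phi) size_Q => /eqP hi -> /=.
  have l1 : l = 1.
    have : l <= 1.
      rewrite -hi -[X in X <= _](size_iota 0 l) -sum1_size leq_sum //.
    by lia.
  have s0 : s (A i 0) = 0 by move: hi; rewrite l1 /= big_seq1 => -[].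
  rewrite inE hs ht !(inj_eq phi_inj) /= /subdivision_source /subdivision_target /=.
  rewrite unlift_none /= /spindle_source /spindle_target /= inord_ord0 unlift_none eqxx /=.
  case: unliftP => [r _|_]; first by exfalso; have := leq_trans (ltn_ord r) (eq_leq s0).
  case: unliftP => [r _|_]; first by exfalso; have := leq_trans (ltn_ord r) (eq_leq (congr1 predn l1)).
  by [].
Qed.

(** * From disjoint paths back to a subdivision *)

Section EmbeddingOfLinkage.
Variables (G : digraph) (rank : vertices G -> nat).
Hypothesis rankP : forall x y, adjacent x y -> rank x < rank y.
Variables (k l : nat) (u v : vertices G) (q : 'I_k -> seq (vertices G)).
Hypotheses (k_gt0 : 0 < k) (l_gt0 : 0 < l) (neq_uv : u != v) (q_link : linkage l u v q).

(** Index 0 is the common start, so the [t]-th arc of path [i] runs from [w i t] to [w i t.+1]. *)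
Let w i t := nth v (u :: q i) t.

Lemma linkage_rank i t t' : t < t' <= size (q i) -> rank (w i t) < rank (w i t').
Proof.
case: q_link => qP _ _ _; have [p _] := qP i.
elim: t' => // t' IH /andP[]; rewrite ltnS leq_eqVlt => /orP[/eqP <-|tt'] ht'.
  by apply: rankP; apply: (pathP v p).
apply: ltn_trans (IH _) _; first by rewrite tt' ltnW.
by apply: rankP; apply: (pathP v p).
Qed.

(** That a path does not repeat vertices is no clause of [linkage]; it follows from the rank, which
    grows along every arc. *)
Lemma linkage_inj i t t' : t <= size (q i) -> t' <= size (q i) -> w i t = w i t' -> t = t'.
Proof.
move=> ht ht' e; case: (ltngtP t t') => // h.
  by have := @linkage_rank i t t'; rewrite h ht' e ltnn => /(_ isT).
by have := @linkage_rank i t' t; rewrite h ht e ltnn => /(_ isT).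
Qed.

Lemma linkage_last i : w i (size (q i)) = v.
Proof. by case: q_link => qP _ _ _; rewrite /w nth_last /= (qP i).2. Qed.

Lemma linkage_meet i i' t t' : t <= size (q i) -> t' <= size (q i') ->
  0 < t -> w i t = w i' t' -> w i t = v \/ i = i' /\ t = t'.
Proof.
move=> ht ht' t_gt0 e; case: (eqVneq i i') => [ei|ni].
  by subst i'; right; split=> //; apply: (linkage_inj ht ht' e).
left; case: q_link => _ _ disj _; apply: (disj i i') => //.
  by rewrite /w -(prednK t_gt0) /= mem_nth // prednK.
by rewrite e mem_nth.
Qed.

(** The whole excess length goes to the last arc of each spindle path and all other arcs are kept.
    Hence the index of an arc in the spindle plus the index inside its subdivision is its position
    along [q i]. *)
Let s (e : arcs (spindle k l)) : nat := if e.2 == l.-1 :> nat then size (q e.1) - l else 0.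

Let pos (e : arcs (spindle k l)) (r : 'I_(s e).+1) := e.2 + r.

Lemma pos_lt e (r : 'I_(s e).+1) : pos r < size (q e.1).
Proof.
have [_ qsize _ _] := q_link; have := qsize e.1.
have := ltn_ord r; rewrite /pos; move: (nat_of_ord r) => m; rewrite /s.
have := ltn_ord e.2; case: eqP => [->|]; lia.
Qed.

Lemma pos_inj (i : 'I_k) (j j' : 'I_l.-1.+1) (r : 'I_(s (i, j)).+1) (r' : 'I_(s (i, j')).+1) :
  pos r = pos r' ->
  existT (fun e => 'I_(s e).+1) (i, j) r = existT (fun e => 'I_(s e).+1) (i, j') r'.
Proof.
move=> e; have ejj : j = j'.
  apply: val_inj; move: e; rewrite /pos /=.
  have := ltn_ord r'; have := ltn_ord r; move: (nat_of_ord r) (nat_of_ord r') => m m'.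
  rewrite /s /=; have := ltn_ord j; have := ltn_ord j'.
  by case: eqP; case: eqP; lia.
subst j'; congr existT; apply: val_inj; move: e; rewrite /pos /=; lia.
Qed.

(** Off the direct paths any arc with the right ends will do. The direct paths all have the same
    ends, so they are matched with distinct arcs from [u] to [v] through the enumerations of [D] and
    [S]; the last condition of [linkage] makes [S] large enough. *)
Lemma linkage_arcs : exists a : 'I_k -> nat -> arcs G,
  [/\ forall i t, t < size (q i) -> source (a i t) = w i t,
      forall i t, t < size (q i) -> target (a i t) = w i t.+1 &
      forall i i', size (q i) = 1 -> size (q i') = 1 -> a i 0 = a i' 0 -> i = i'].
Proof.
have [qP qsize _ qdirect] := q_link.
have adj i t : t < size (q i) -> 0 < multiplicity (w i t) (w i t.+1).
  by move=> ht; apply: (pathP v (qP i).1).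
have [a0 _] : exists a : arcs G, true.
  have i0 : 'I_k := Ordinal k_gt0.
  have := adj i0 0 (leq_trans l_gt0 (qsize i0)).
  by rewrite card_gt0 => /set0Pn[a _]; exists a.
pose D := [set i | size (q i) == 1].
pose S := [set a : arcs G | (source a == u) && (target a == v)].
pose d i := nth a0 (enum S) (index i (enum D)).
pose b i t := odflt a0 [pick a : arcs G | (source a == w i t) && (target a == w i t.+1)].
have bP i t : t < size (q i) -> source (b i t) = w i t /\ target (b i t) = w i t.+1.
  move=> /adj; rewrite /b; case: pickP => [a /andP[/eqP -> /eqP ->] //|no].
  by rewrite card_gt0 => /set0Pn[a]; rewrite inE no.
have index_lt i : i \in D -> index i (enum D) < size (enum S).
  move=> iD; rewrite -cardE; apply: leq_trans qdirect.
  by rewrite [X in _ < X]cardE index_mem mem_enum.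
have dP i : i \in D -> source (d i) = u /\ target (d i) = v.
  move=> /index_lt /(mem_nth a0); rewrite -/(d i) mem_enum inE.
  by move=> /andP[/eqP -> /eqP ->].
exists (fun i t => if size (q i) == 1 then d i else b i t); split.
- move=> i t ht; case: ifP => [h|_]; last by have [] := bP i t ht.
  have [|-> _] := dP i; first by rewrite inE.
  by move: ht; rewrite (eqP h); case: t.
- move=> i t ht; case: ifP => [h|_]; last by have [] := bP i t ht.
  have [|_ ->] := dP i; first by rewrite inE.
  by rewrite -(linkage_last i); move: ht; rewrite (eqP h); case: t.
move=> i i' hi hi'; rewrite hi hi' !eqxx /d => /eqP.
have [iD i'D] : i \in D /\ i' \in D by rewrite !inE hi hi'.
rewrite nth_uniq ?enum_uniq ?index_lt // => /eqP e.
by rewrite -[i](nth_index i (s := enum D)) ?mem_enum // e nth_index // mem_enum.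
Qed.

(** Coordinates of a vertex: an end-vertex, or a path and a position on it. The spindle's own
    internal vertices take the positions below [l.-1], the new vertices continue from there;
    position [t] is sent to [w i t.+1]. *)
Let node (x : vertices (subdivision s)) : bool + 'I_k * nat :=
  match x with
  | inl (inl b) => inl b
  | inl (inr (i, j)) => inr (i, nat_of_ord j)
  | inr y => inr ((tag y).1, (tag y).2 + tagged y)
  end.

Lemma node_inj : injective node.
Proof.
have bound (i : 'I_k) (j : 'I_l.-1.+1) (r : 'I_(s (i, j))) :
    nat_of_ord j = l.-1 /\ r < size (q i) - l.
  by have := ltn_ord r; move: (nat_of_ord r) => m; rewrite /s /=; case: eqP.
move=> [[b|[i j]]|[[i j] r]] [[b'|[i' j']]|[[i' j'] r']] //=.
- by move=> [->].
- by move=> [-> /val_inj ->].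
- by move=> [_]; have := ltn_ord j; have := bound i' j' r'; lia.
- by move=> [_]; have := ltn_ord j'; have := bound i j r; lia.
move=> [ei ej]; subst i'.
have ejj : j = j' by apply: val_inj; rewrite /= (bound _ _ r).1 (bound _ _ r').1.
by subst j'; congr inr; congr existT; apply: val_inj; move: ej => /=; lia.
Qed.

Lemma node_lt x i t : node x = inr (i, t) -> t.+1 < size (q i).
Proof.
have [_ qsize _ _] := q_link.
case: x => [[b|[i' j]]|[[i' j] r]] //= [<- <-]; have := qsize i'.
  by have := ltn_ord j; lia.
have := ltn_ord r; move: (nat_of_ord r) => m; rewrite /s /=; case: eqP; lia.
Qed.

Lemma embedding_of_linkage : contains_subdivision G (spindle k l).
Proof.
apply/contains_subdivision_embeds; exists s.
have [a [a_src a_tgt a_dir]] := linkage_arcs.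
have [_ qsize _ _] := q_link.
pose psi (x : arcs (subdivision s)) : arcs G := a (tag x).1 (pos (tagged x)).
pose phi (x : vertices (subdivision s)) : vertices G :=
  match node x with
  | inl b => if b then v else u
  | inr (i, t) => w i t.+1
  end.
exists phi, psi; split.
- have not_u i t : t.+1 < size (q i) -> w i t.+1 <> u.
    by move=> ht; rewrite -[u]/(w i 0) => /(linkage_inj (ltnW ht)) -/(_ isT).
  have not_v i t : t.+1 < size (q i) -> w i t.+1 <> v.
    by move=> ht; rewrite -(linkage_last i) => /(linkage_inj (ltnW ht) (leqnn _)); lia.
  move=> x y; rewrite /phi => e; apply: node_inj; move: e.
  case ex: (node x) => [b|[i t]]; case ey: (node y) => [b'|[i' t']].
  + by case: b {ex}; case: b' {ey} => //= e; move: neq_uv; rewrite e eqxx.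
  + have ht := node_lt ey.
    by case: b {ex} => /esym; [move/(not_v _ _ ht) | move/(not_u _ _ ht)].
  + have ht := node_lt ex.
    by case: b' {ey}; [move/(not_v _ _ ht) | move/(not_u _ _ ht)].
  + have ht := node_lt ex; have ht' := node_lt ey.
    by case/(linkage_meet (ltnW ht) (ltnW ht') isT) => [/(not_v _ _ ht) //|[-> [->]]].
- move=> [[i j] r] [[i' j'] r']; rewrite /psi /= => e.
  have ht := pos_lt r; have ht' := pos_lt r'; simpl in ht, ht'.
  have es := congr1 (@source G) e; have et := congr1 (@target G) e.
  rewrite !a_src // in es; rewrite !a_tgt // in et.
  (* A common head other than [v] determines path and position. If the head is [v], both arcs are
     last on their paths and the common tail decides, unless it is [u]; then both paths are direct
     and [a_dir] separates them. *)
  have [ev|[ei [ep]]] := linkage_meet ht ht' isT et; last first.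
    by subst i'; apply: pos_inj.
  have last_pos x t : t < size (q x) -> w x t.+1 = v -> t.+1 = size (q x).
    by move=> hx; rewrite -(linkage_last x) => /(linkage_inj hx (leqnn _)).
  have last1 := last_pos _ _ ht ev; have last2 := last_pos _ _ ht' (etrans (esym et) ev).
  have not_v x t : t < size (q x) -> w x t <> v.
    move=> hx; rewrite -(linkage_last x) => /(linkage_inj (ltnW hx) (leqnn _)); lia.
  have [p0|p0] := posnP (pos r); last first.
    have [/not_v //|[ei ep]] := linkage_meet (ltnW ht) (ltnW ht') p0 es.
    by subst i'; apply: pos_inj.
  have [p0'|p0'] := posnP (pos r'); last first.
    have [/not_v //|[ei ep]] := linkage_meet (ltnW ht') (ltnW ht) p0' (esym es).
    by subst i'; apply: pos_inj.
  rewrite p0 in last1 e; rewrite p0' in last2 e.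
  have ei := a_dir _ _ (esym last1) (esym last2) e; subst i'.
  by apply: pos_inj; rewrite p0 p0'.
- move=> [[i j] r]; rewrite /psi /= a_src; last exact: (@pos_lt (i, j)).
  rewrite /subdivision_source /pos /=.
  case: unliftP => [r' ->|->]; first by rewrite lift0 addnS.
  rewrite addn0 /= /spindle_source /=.
  by case: unliftP => [j' ->|->]; rewrite ?lift0.
- move=> [[i j] r]; rewrite /psi /= a_tgt; last exact: (@pos_lt (i, j)).
  rewrite /subdivision_target /pos /=.
  case: unliftP => [r' ->|->]; first by rewrite lift_max.
  rewrite /= /spindle_target /=.
  have sE : s (i, j) = if j == l.-1 :> nat then size (q i) - l else 0 by [].
  case: unliftP => [j' ej|ej].
    move: sE; rewrite {2}ej lift_max ltn_eqF // => ->.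
    by rewrite addn0 ej lift_max.
  rewrite sE ej -[RHS]/v -(linkage_last i) /= eqxx; congr w.
  by have := qsize i; lia.
Qed.

End EmbeddingOfLinkage.

(** * The token game *)

Section Game.
Variables (n : nat) (A : nat -> nat -> nat) (v k : nat).
Hypothesis A_lt : forall x y, 0 < A x y -> x < y < n.

Definition edge : rel nat := fun x y => 0 < A x y.

Lemma edge_path_lt x q y : path edge x q -> y \in q -> x < y < n.
Proof.
elim: q x => //= z q IH x /andP[/A_lt xz /IH h].
rewrite inE => /orP[/eqP -> //|/h]; lia.
Qed.

Lemma edge_path_loop x q : path edge x q -> last x q = x -> q = [::].
Proof.
case/lastP: q => // q y hp; rewrite last_rcons => e.
by have := edge_path_lt hp (y := y); rewrite mem_rcons mem_head e ltnn => /(_ isT).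
Qed.

(* Token [i < k] stands at [p i] and must still visit at least [c i] internal
   vertices on its way to [v].  Among the tokens at the same vertex, those that
   use a direct arc to [v] are required to come last in the order of their
   indices. *)
Definition routable (p c : nat -> nat) : Prop :=
  exists q : nat -> seq nat,
  [/\ forall i, i < k -> path edge (p i) (q i) /\ last (p i) (q i) = v,
      forall i, i < k -> p i != v -> c i < size (q i),
      forall i, i < k -> size (q i) = 1 -> \sum_(i <= j < k) (p j == p i) <= A (p i) v &
      forall i j x, i < k -> j < k -> i != j -> x \in q i -> x \in p j :: q j -> x = v].

Lemma routable_end p c : (forall i, i < k -> p i = v) -> routable p c.
Proof.
move=> pv; exists (fun=> [::]); split=> //.
  by move=> i hi; rewrite pv.
by move=> i hi; rewrite pv // eqxx.
Qed.

(** For a move into [v] the sum runs over all tokens at [p i], whereas [routable] sums from [i] on.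
    The two agree for the token of least index at its vertex, the only one that is ever moved. *)
Definition movable (p c : nat -> nat) (i w : nat) : bool :=
  (p i < w < n) &&
  if w == v then (c i == 0) && (\sum_(j < k) (p j == p i) <= A (p i) w)
  else (\sum_(j < k) (p j == w) == 0) && (0 < A (p i) w).

(** A routing is cut after, or extended by, the first arc of token [i]. The extension stays disjoint
    from the other routes because arcs go upwards: a route passing through [p i] would belong to a
    token standing earlier. *)
Lemma routable_move p c i : i < k -> p i != v ->
  (forall j, j < k -> p j != v -> p i <= p j) ->
  (forall j, j < i -> p j != v -> p i < p j) ->
  routable p c <-> exists w, movable p c i w /\
    routable (update p i w) (update c i (c i).-1).
Proof.
move=> hi piv pmin pfirst.
have pne j : j < i -> p j != p i.
  move=> ji; case: (eqVneq (p j) v) => [->|/(pfirst _ ji)]; first by rewrite eq_sym.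
  lia.
split=> [[q [qP qc qd qx]]|[w [/andP[/andP[piw wn] hw] [q [qP qc qd qx]]]]].
  have [pi1 pi2] := qP i hi.
  case eq: (q i) => [|w q'].
    by move: pi2 piv; rewrite eq /= => -> /eqP.
  rewrite eq /= in pi1 pi2; have [ew pq'] := andP pi1.
  have /andP[piw wn] := A_lt ew.
  have w_free j : j < k -> p j = w -> w = v.
    move=> hj e; apply: (qx i j); rewrite ?eq ?mem_head ?e ?mem_head //.
    by apply/eqP => e'; move: piw; rewrite e' e ltnn.
  exists w; split.
    rewrite /movable piw wn /=; case: (eqVneq w v) => [ewv|nwv].
      have q'0 : q' = [::] by apply: (edge_path_loop pq'); rewrite pi2 ewv.
      have := qc i hi piv; rewrite eq q'0 /= ltnS leqn0 => ->.
      have := qd i hi; rewrite eq q'0 => /(_ erefl); rewrite ewv; apply: leq_trans.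
      rewrite -(big_mkord xpredT (fun j => p j == p i : nat)).
      rewrite (@big_cat_nat _ _ _ i) //= ?(ltnW hi) // big_nat big1 // => j /andP[_ /pne].
      by move/negbTE ->.
    rewrite [0 < _]ew andbT sum_nat_eq0; apply/forallP => j /=.
    by rewrite eqb0; apply/eqP => /(w_free _ (ltn_ord j)) /eqP; rewrite (negbTE nwv).
  exists (fun j => if j == i then q' else q j).
  split=> [j hj|j hj|j hj|a b x ha hb nab]; rewrite /update.
  - by case: (eqVneq j i) => // _; apply: qP.
  - case: (eqVneq j i) => [_|_] hv; last exact: qc.
    have := qc i hi piv; rewrite eq /=.
    have : 0 < size q' by case: (q') pi2 hv => //= -> /eqP.
    lia.
  - case: (eqVneq j i) => [ej|nji] hs.
      have ev : w != v.
        by apply/eqP => e; have := edge_path_loop pq'; rewrite pi2 e => /(_ erefl) h; rewrite h in hs.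
      (* No other token stands at [w], so the sum to be bounded is 1 and a single arc from [w] to
         [v] suffices. *)
      have hA : 0 < A w v.
        by case: (q') hs pi2 pq' => [//|y [|//]] _ /= -> /andP[].
      apply: leq_trans hA; rewrite ej (big_ltn hi) eqxx eqxx -[X in _ <= X]addn0 leq_add2l.
      rewrite leqn0 big_nat big1 // => j' /andP[ij' hj'].
      rewrite (gtn_eqF ij'); case: eqP => // /(w_free _ hj') e; by rewrite e eqxx in ev.
    (* The count for another token [j] could only grow if token [i] arrived at [p j]. That happens
       only at [v], where the route of [j] is empty and not of length one. *)
    apply: leq_trans (qd j hj hs); apply: leq_sum => j' _.
    case: (eqVneq j' i) => // _; case: eqP => // e.
    have ev := w_free j hj (esym e).
    have [pj1 pj2] := qP j hj.
    have := edge_path_loop pj1; rewrite pj2 -e ev => /(_ erefl) h.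
    by rewrite h in hs.
  - case: (eqVneq a i) => [ea|nai]; case: (eqVneq b i) => [eb|nbi].
    + by move: nab; rewrite ea eb eqxx.
    + move=> xq'; apply: (qx i b) => //; last by rewrite eq inE xq' orbT.
      by rewrite eq_sym.
    + move=> xa xi; apply: (qx i a); rewrite ?eq // 1?eq_sym //.
      by rewrite inE xa orbT.
    + exact: qx.
have pU j : j != i -> update p i w j = p j by rewrite /update => /negbTE ->.
have cU j : j != i -> update c i (c i).-1 j = c j by rewrite /update => /negbTE ->.
have pI : update p i w i = w by rewrite /update eqxx.
have cI : update c i (c i).-1 i = (c i).-1 by rewrite /update eqxx.
have ew : edge (p i) w.
  move: hw; case: eqP => _ /andP[_] //; apply: leq_trans.
  by rewrite (bigD1 (Ordinal hi)) //= eqxx.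
have w_free j : j < k -> p j = w -> w = v.
  move=> hj e; move: hw; case: eqP => // _ /andP[].
  by rewrite sum_nat_eq0 => /forallP/(_ (Ordinal hj)); rewrite /= e eqxx.
have [pi1 pi2] := qP i hi; rewrite pI in pi1 pi2.
exists (fun j => if j == i then w :: q i else q j).
split=> [j hj|j hj|j hj|a b x ha hb nab].
- case: (eqVneq j i) => [->|nji] /=; first by rewrite ew.
  by have := qP j hj; rewrite pU.
- case: (eqVneq j i) => [->|nji] hv /=; last by have := qc j hj; rewrite pU // cU //; apply.
  have := qc i hi; rewrite pI cI; case: (eqVneq w v) hw => [_ /andP[/eqP -> //]|_ _ /(_ isT)].
  lia.
- case: (eqVneq j i) => [->|nji] /= hs.
    have q0 : q i = [::] by case: (q i) hs.
    have wv : w = v by rewrite q0 in pi2.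
    move: hw; rewrite wv eqxx => /andP[_]; apply: leq_trans.
    rewrite -(big_mkord xpredT (fun j => p j == p i : nat)).
    by rewrite (@big_cat_nat _ _ _ i 0 k) //= ?(ltnW hi) // leq_addl.
  have := qd j hj hs; rewrite pU //; apply: leq_trans.
  rewrite big_nat [X in _ <= X]big_nat; apply: leq_sum => j' /andP[jj' hj'].
  case: (eqVneq j' i) => [ej|nj]; last by rewrite pU.
  have : p j != p i by apply: pne; lia.
  by rewrite ej eq_sym => /negbTE ->.
case: (eqVneq a i) => [ea|nai]; case: (eqVneq b i) => [eb|nbi].
- by move: nab; rewrite ea eb eqxx.
- rewrite !inE => /orP[/eqP ->|xi] /orP[/eqP e|xb].
  + exact: (w_free b).
  + by apply: (qx b i) => //; rewrite pI mem_head.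
  + by apply: (qx i b); rewrite // 1?eq_sym // pU // e mem_head.
  + by apply: (qx i b); rewrite // 1?eq_sym // inE xb orbT.
(* The one place where the minimality of [p i] is used: a vertex on the route of token [a] lies
   strictly above [p a], hence above [p i]. *)
- rewrite inE => xa /orP[/eqP e|xi]; last by apply: (qx a i); rewrite // pI.
  have [pa1 pa2] := qP a ha; rewrite pU // in pa1 pa2.
  have pav : p a != v.
    apply/eqP => h; have := edge_path_loop pa1; rewrite pa2 h => /(_ erefl) qa.
    by rewrite qa in xa.
  have := edge_path_lt pa1 xa; have := pmin a ha pav; rewrite e eb; lia.
- by move=> xa xb; apply: (qx a b) => //; rewrite pU.
Qed.

End Game.

(** * Numbers in base [B] and their digits *)

Section Digits.
Variables (k B : nat).

Definition encode (d : nat -> nat) : nat := \sum_(j < k) d j * B ^ j.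

Lemma digits_lt m (d : nat -> nat) : (forall j, j < m -> d j < B) ->
  \sum_(j < m) d j * B ^ j < B ^ m.
Proof.
elim: m => [|m IH] hd; first by rewrite big_ord0.
rewrite big_ord_recr /= expnS.
have h1 := IH (fun j hj => hd j (ltnW hj)).
have h2 := hd m (leqnn _).
apply: (@leq_trans ((d m).+1 * B ^ m)); last by rewrite leq_mul2r h2 orbT.
by rewrite mulSn ltn_add2r.
Qed.

Lemma encode_inj d d' : (forall j, j < k -> d j < B) -> (forall j, j < k -> d' j < B) ->
  encode d = encode d' -> forall j, j < k -> d j = d' j.
Proof.
rewrite /encode; elim: k => // m IH hd hd'; rewrite !big_ord_recr /= => e j.
have l1 := digits_lt (fun j (hj : j < m) => hd j (ltnW hj)).
have l2 := digits_lt (fun j (hj : j < m) => hd' j (ltnW hj)).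
have pos : 0 < B ^ m by apply: leq_ltn_trans l1.
have em : d m = d' m.
  by have := congr1 (divn^~ (B ^ m)) e; rewrite !divnDMl // !divn_small.
rewrite ltnS leq_eqVlt => /orP[/eqP -> //|]; apply: IH.
- by move=> i /ltnW; apply: hd.
- by move=> i /ltnW; apply: hd'.
by move/eqP: e; rewrite em eqn_add2r => /eqP.
Qed.

Lemma encode_update d i x : i < k ->
  encode (update d i x) + d i * B ^ i = encode d + x * B ^ i.
Proof.
move=> hi; rewrite /encode (bigD1 (Ordinal hi)) //= [in RHS](bigD1 (Ordinal hi)) //=.
rewrite {1}/update eqxx.
rewrite (eq_bigr (fun j : 'I_k => d j * B ^ j)); first by lia.
by move=> j nj; rewrite /update ifF //; apply/negbTE.
Qed.

End Digits.

(** Once the elements satisfying [a] are moved to the end, everything from the first of them on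
    satisfies [a]. With [a] marking the direct paths, this is the inequality that [routable] asks
    for. *)
Lemma nth_mem_filter (T : eqType) (a : pred T) x0 s i :
  let s' := [seq x <- s | ~~ a x] ++ [seq x <- s | a x] in
  i < size s' -> a (nth x0 s' i) -> size s' - i <= count a s.
Proof.
move=> s' hi; rewrite /s' nth_cat; case: ltnP => h.
  by have := mem_nth x0 h; rewrite mem_filter => /andP[/negbTE ->].
by move=> _; rewrite size_cat (size_filter a) leq_subLR leq_add2r.
Qed.

(** * Spindles in a topologically numbered digraph *)

Section SortedVertices.
Variables (n k l : nat) (G : digraph) (g : 'I_n -> vertices G) (A : nat -> nat -> nat).
Hypotheses (g_bij : bijective g) (k_gt0 : 0 < k) (l_gt0 : 0 < l).
Hypothesis A_lt : forall x y, 0 < A x y -> x < y < n.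
Hypothesis A_mult : forall i j : 'I_n, A i j = multiplicity (g i) (g j).

Lemma contains_spindle_routable :
  contains_subdivision G (spindle k l) <->
  exists u v, u < v < n /\ routable A v k (fun=> u) (fun=> l.-1).
Proof.
have [g' gK Kg] := g_bij.
have adjE x y : adjacent x y = edge A (g' x) (g' y).
  by rewrite /edge A_mult !Kg.
split.
  move=> /contains_subdivision_embeds[s /(linkage_of_embedding l_gt0)].
  move=> [u [v [q [neq_uv [qP qsize qdisj qdirect]]]]].
  pose r x : nat := g' x.
  have r_inj : injective r by move=> x y /val_inj/(can_inj Kg).
  pose a i := size (q i) == 1; pose i0 : 'I_k := Ordinal k_gt0.
  (* The paths are renumbered with the direct ones last. *)
  pose idx := [seq i <- enum 'I_k | ~~ a i] ++ [seq i <- enum 'I_k | a i].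
  have idx_perm : perm_eq idx (enum 'I_k) by rewrite /idx perm_catC perm_filterC.
  have idx_size : size idx = k by rewrite (perm_size idx_perm) size_enum_ord.
  have idx_uniq : uniq idx by rewrite (perm_uniq idx_perm) enum_uniq.
  pose Q i := map r (q (nth i0 idx i)).
  have Q_path i : path (edge A) (r u) (Q i) /\ last (r u) (Q i) = r v.
    have [p1 p2] := qP (nth i0 idx i); rewrite /Q last_map p2; split=> //.
    elim: (q _) (u) p1 {p2} => //= y p IH x /andP[xy yp].
    by rewrite IH // -adjE xy.
  have uv : r u < r v < n.
    have [p1 p2] := Q_path 0; apply: (edge_path_lt A_lt p1); rewrite -p2.
    have := qsize (nth i0 idx 0); rewrite -(size_map r) -/(Q 0).
    by case: (Q 0) => [|y p] /=; [lia | rewrite mem_last].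
  exists (r u), (r v); split=> //; exists Q; split=> //.
  - by move=> i _ _; rewrite size_map prednK.
  - move=> i hi; rewrite size_map => hs.
    have -> : A (r u) (r v) = multiplicity u v by rewrite A_mult !Kg.
    apply: leq_trans qdirect; under eq_bigr do rewrite eqxx.
    rewrite sum_nat_const_nat muln1 cardE size_filter -enumT.
    rewrite -{1}idx_size (eq_count (a2 := a)); last by move=> x /=; rewrite inE.
    by apply: (@nth_mem_filter _ a i0); rewrite ?idx_size // -/idx /a hs.
  - move=> i j x hi hj nij /mapP[y yi ->]; rewrite -map_cons (mem_map r_inj) => yj.
    congr r; apply: qdisj yi yj; rewrite nth_uniq ?idx_size //.
move=> [u [v [/andP[uv vn] [q [qP qsize qdirect qdisj]]]]].
have un : u < n by apply: ltn_trans vn.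
pose h x := g (insubd (Ordinal un) x).
have g'h x : x < n -> g' (h x) = x :> nat by move=> hx; rewrite /h gK val_insubd hx.
have Q_lt i x : i < k -> x \in u :: q i -> x < n.
  move=> hi; rewrite inE => /orP[/eqP -> //|xi].
  by have := edge_path_lt A_lt (qP i hi).1 xi; lia.
have rankP x y : adjacent x y -> g' x < g' y by rewrite adjE => /A_lt/andP[].
have h_inj i j x y : i < k -> j < k -> x \in u :: q i -> y \in u :: q j -> h x = h y -> x = y.
  by move=> hi hj /(Q_lt _ _ hi) hx /(Q_lt _ _ hj) hy e; rewrite -(g'h x) // e g'h.
apply: (@embedding_of_linkage G (fun x => g' x) rankP k l (h u) (h v) (fun i : 'I_k => map h (q i))) => //.
  apply/eqP => /(congr1 g')/(congr1 val) /=; rewrite !g'h //; lia.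
split.
- move=> i; have [p1 p2] := qP i (ltn_ord i); rewrite last_map p2; split=> //.
  have : all (fun x => x < n) (u :: q i) by apply/allP => x; apply: Q_lt.
  elim: (q i) (u) p1 {p2} => //= y p IH x /andP[xy yp] /and3P[hx hy hp].
  by rewrite adjE !g'h // xy IH //= hy.
- move=> i; rewrite size_map; have := qsize i (ltn_ord i); rewrite neq_ltn uv.
  by move=> /(_ isT); lia.
- move=> i j x nij /mapP[y yi ->]; rewrite -map_cons => /mapP[z zj e]; congr h.
  apply: (qdisj i j) => //.
  by rewrite (h_inj i j y z) // inE yi orbT.
set D := [set i | _].
have [->|[i1 i1D]] := set_0Vmem D; first by rewrite cards0.
(* Every direct path has index at least [i0], so there are at most [k - i0] of them, and this is the
   sum that [qdirect] bounds at [i0]. *)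
have [i0 i0D i0min] := @arg_minnP _ i1 (mem D) (fun i => nat_of_ord i) i1D.
have := qdirect i0 (ltn_ord i0).
have -> : size (q i0) = 1 by move: i0D; rewrite /D /= inE (size_map h) => /eqP.
move=> /(_ erefl).
have -> : A u v = multiplicity (h u) (h v).
  have := A_mult (g' (h u)) (g' (h v)); rewrite !g'h // => ->.
  by rewrite !Kg.
apply: leq_trans; under [X in _ <= X]eq_bigr do rewrite eqxx.
rewrite (big_geq_mkord _ _ xpredT) -sum1_card [X in _ <= X]big_mkcond [X in X <= _]big_mkcond /=.
by apply: leq_sum => i _; case: ifP => // iD; rewrite i0min.
Qed.

End SortedVertices.

(** * Structured programs and their translation *)

Inductive expr :=
  | Var (r : nat)
  | Num (c : nat)
  | Plus (e1 e2 : expr)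
  | Minus (e1 e2 : expr)
  | Cell (a : nat) (e : expr)
  | Input (e : expr).

(** Loops run as often as register [b] says on entry, so [eval] is a total structural recursion and
    termination needs no argument. *)
Inductive cmd :=
  | Skip
  | Assign (x : nat) (e : expr)
  | Store (a : nat) (e1 e2 : expr)
  | Seq (c1 c2 : cmd)
  | If (e1 e2 : expr) (c1 c2 : cmd)
  | For (x b : nat) (c : cmd).

Record store := Mk { reg : nat -> nat; arr : nat -> nat -> nat }.

Definition set_reg (s : store) (x v : nat) : store :=
  Mk (update (reg s) x v) (arr s).

Definition set_cell (s : store) (a i v : nat) : store :=
  Mk (reg s) (fun a' => if a' == a then update (arr s a) i v else arr s a').

Definition expr_eval (inp : nat -> nat) (s : store) : expr -> nat :=
  fix ev e := match e with
  | Var r => reg s r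
  | Num c => c
  | Plus e1 e2 => ev e1 + ev e2
  | Minus e1 e2 => ev e1 - ev e2
  | Cell a e => arr s a (ev e)
  | Input e => inp (ev e)
  end.

Fixpoint eval (inp : nat -> nat) (c : cmd) (s : store) : store :=
  match c with
  | Skip => s
  | Assign x e => set_reg s x (expr_eval inp s e)
  | Store a e1 e2 => set_cell s a (expr_eval inp s e1) (expr_eval inp s e2)
  | Seq c1 c2 => eval inp c2 (eval inp c1 s)
  | If e1 e2 c1 c2 =>
      if expr_eval inp s e1 < expr_eval inp s e2
      then eval inp c1 s else eval inp c2 s
  | For x b c => iteri (reg s b) (fun j s' => eval inp c (set_reg s' x j)) s
  end.

Fixpoint expr_size (e : expr) : nat :=
  match e with
  | Var _ | Num _ => 1
  | Plus e1 e2 | Minus e1 e2 => expr_size e1 + expr_size e2 + 1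
  | Cell _ e => expr_size e + 7
  | Input e => expr_size e + 3
  end.

(** This is the exact number of machine steps of the translation. The second branch of [If] pays 1
    for jumping over the first; a loop pays 4 for three set-up instructions and the final test, and
    3 per round for test, copy of the counter to [x], and increment. *)
Fixpoint time (inp : nat -> nat) (c : cmd) (s : store) : nat :=
  match c with
  | Skip => 0
  | Assign x e => expr_size e + 1
  | Store a e1 e2 => expr_size e1 + 6 + expr_size e2 + 1
  | Seq c1 c2 => time inp c1 s + time inp c2 (eval inp c1 s)
  | If e1 e2 c1 c2 => expr_size e1 + expr_size e2 + 1 +
      if expr_eval inp s e1 < expr_eval inp s e2
      then time inp c1 s else time inp c2 s + 1
  | For x b c => 4 + \sum_(i < reg s b)
      (3 + time inp c (set_reg
         (iteri i (fun j s' => eval inp c (set_reg s' x j)) s) x i))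
  end.

(* Registers below [nvars] hold the variables.  The next three hold the address
   [base] of the first cell behind the input, the constant 1 and the constant 0.
   All later registers are temporaries, allocated as a stack from [d] on. *)
Definition nvars := 28.
Definition base := nvars.
Definition one := nvars.+1.
Definition zero := nvars.+2.
Definition temp := nvars.+3.

(* The eight arrays are interleaved: cell [i] of array [a] is stored at
   [base + (8 * i + a).+1].  Address [base] itself always holds 0. *)
Definition code_address (a d : nat) : program :=
  [:: Add d d d; Add d d d; Add d d d; Const d.+1 a.+1; Add d d d.+1;
      Add d d base].

Fixpoint code_expr (e : expr) (d : nat) : program :=
  match e with
  | Var r => [:: Add d r zero]
  | Num c => [:: Const d c]
  | Plus e1 e2 => code_expr e1 d ++ code_expr e2 d.+1 ++ [:: Add d d d.+1]
  | Minus e1 e2 => code_expr e1 d ++ code_expr e2 d.+1 ++ [:: Defs.Sub d d d.+1]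
  | Cell a e => code_expr e d ++ code_address a d ++ [:: Read d d]
  (* Reads at [minn i base], so that the input continues with zeros. *)
  | Input e => code_expr e d ++ [:: Defs.Sub d.+1 d base; Defs.Sub d d d.+1; Read d d]
  end.

(** The counter of a loop and a copy of its bound sit in [d] and [d.+1], out of reach of the body,
    which is compiled from [d.+2] on. A loop is entered by a jump to the test at its end. In [If]
    the second branch is laid out first and ends with the always taken [JumpLt zero one]. *)
Fixpoint code (c : cmd) (q d : nat) : program :=
  match c with
  | Skip => [::]
  | Assign x e => code_expr e d ++ [:: Add x d zero]
  | Store a e1 e2 => code_expr e1 d ++ code_address a d ++
                     code_expr e2 d.+1 ++ [:: Write d d.+1]
  | Seq c1 c2 => let p1 := code c1 q d in p1 ++ code c2 (q + size p1) d
  | If e1 e2 c1 c2 =>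
      let q2 := q + expr_size e1 + expr_size e2 + 1 in
      let p2 := code c2 q2 d in
      let q1 := q2 + size p2 + 1 in
      let p1 := code c1 q1 d in
      code_expr e1 d ++ code_expr e2 d.+1 ++ [:: JumpLt d d.+1 q1] ++
      p2 ++ [:: JumpLt zero one (q1 + size p1)] ++ p1
  | For x b c =>
      let p := code c (q + 4) d.+2 in
      [:: Const d 0; Add d.+1 b d; JumpLt d one (q + 5 + size p);
          Add x d zero] ++
      p ++ [:: Add d d one; JumpLt d d.+1 (q + 3)]
  end.

Fixpoint expr_wf (e : expr) : bool :=
  match e with
  | Var r => r < nvars
  | Num _ => true
  | Plus e1 e2 | Minus e1 e2 => expr_wf e1 && expr_wf e2
  | Cell a e => (a < 8) && expr_wf e
  | Input e => expr_wf e
  end.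

Fixpoint wf (c : cmd) : bool :=
  match c with
  | Skip => true
  | Assign x e => (x < nvars) && expr_wf e
  | Store a e1 e2 => [&& a < 8, expr_wf e1 & expr_wf e2]
  | Seq c1 c2 => wf c1 && wf c2
  | If e1 e2 c1 c2 => [&& expr_wf e1, expr_wf e2, wf c1 & wf c2]
  | For x b c => [&& x < nvars, b < nvars & wf c]
  end.

Definition located (p : program) (q : nat) (l : program) : Prop :=
  exists pre post, p = pre ++ l ++ post /\ size pre = q.

Lemma located_cat p q l1 l2 :
  located p q (l1 ++ l2) -> located p q l1 /\ located p (q + size l1) l2.
Proof.
move=> [pre [post [-> <-]]]; split; first by exists pre, (l2 ++ post); rewrite -!catA.
by exists (pre ++ l1), post; rewrite size_cat -!catA.
Qed.

Lemma located_cons p q i l :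
  located p q (i :: l) -> onth p q = Some i /\ located p q.+1 l.
Proof.
move=> [pre [post [-> <-]]]; split; last first.
  by exists (rcons pre i), post; rewrite size_rcons cat_rcons.
by rewrite onth_cat ltnn subnn.
Qed.

Lemma runD p t1 t2 s : run p (t1 + t2) s = run p t2 (run p t1 s).
Proof. by rewrite /run addnC iterD. Qed.

Lemma run_step p q R M i t :
  onth p q = Some i ->
  run p t.+1 (State q R M) = run p t (execute i (State q R M)).
Proof. by move=> e; rewrite /run iterSr /step /= e. Qed.

Lemma update_eq R x v : update R x v x = v.
Proof. by rewrite /update eqxx. Qed.

Lemma update_ne R x v y : y != x -> update R x v y = R y.
Proof. by rewrite /update => /negbTE ->. Qed.

Lemma size_code_expr e d : size (code_expr e d) = expr_size e.
Proof.
elim: e d => //= [e1 IH1 e2 IH2|e1 IH1 e2 IH2|a e IH|e IH] d;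
  by rewrite !size_cat /= ?IH1 ?IH2 ?IH //; lia.
Qed.

Local Arguments run : simpl never.

Lemma size_code_address a d : size (code_address a d) = 6.
Proof. by []. Qed.

(** * Correctness of the translation *)

Section Simulation.
Variables (inp : nat -> nat) (n0 : nat) (p : program).
Hypothesis inp0 : forall x, n0 <= x -> inp x = 0.

Definition simulates (s : store) (R M : nat -> nat) : Prop :=
  [/\ forall r, r < nvars -> R r = reg s r,
      [/\ R base = n0, R one = 1 & R zero = 0],
      forall x, x <= n0 -> M x = inp x &
      forall a i, a < 8 -> M (n0 + (8 * i + a).+1) = arr s a i].

Lemma simulates_temp s R R' M :
  simulates s R M -> (forall r, r < temp -> R' r = R r) -> simulates s R' M.
Proof.
move=> [h1 [h2 h3 h4] h5 h6] hR; split=> //; last by rewrite !hR.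
by move=> r hr; rewrite hR ?h1 //; rewrite /temp; lia.
Qed.

Lemma simulates_set s R M x v :
  x < nvars -> simulates s R M -> simulates (set_reg s x v) (update R x v) M.
Proof.
move=> hx [h1 [h2 h3 h4] h5 h6]; split=> //=.
- by move=> r hr; rewrite /update; case: eqP => // _; apply: h1.
- by rewrite !update_ne // neq_ltn ?/one ?/zero ?/base; apply/orP; right; lia.
Qed.

Lemma run_address q R M a d :
  located p q (code_address a d) -> temp <= d ->
  exists R', [/\ run p 6 (State q R M) = State (q + 6) R' M,
    R' d = R base + (8 * R d + a).+1 & forall r, r < d -> R' r = R r].
Proof.
rewrite /code_address.
move=> /located_cons[h1] /located_cons[h2] /located_cons[h3] /located_cons[h4].
move=> /located_cons[h5] /located_cons[h6] _ hd.
have hb : base < d by apply: leq_trans hd.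
have n1 : (d == d.+1) = false by lia.
have n2 : (base == d) = false by lia.
have n3 : (base == d.+1) = false by lia.
eexists; split.
- by rewrite (run_step _ _ _ h1) (run_step _ _ _ h2) (run_step _ _ _ h3) (run_step _ _ _ h4)
    (run_step _ _ _ h5) (run_step _ _ _ h6) !addnS addn0.
- by rewrite /update !eqxx ?n1 ?n2 ?n3; lia.
move=> r hr; have r1 : (r == d) = false by lia.
have r2 : (r == d.+1) = false by lia.
by rewrite /update r1 r2.
Qed.

Local Opaque code_address.

Lemma run_expr e q s R M d :
  located p q (code_expr e d) -> temp <= d -> expr_wf e -> simulates s R M ->
  exists R', [/\ run p (expr_size e) (State q R M) = State (q + expr_size e) R' M,
    R' d = expr_eval inp s e & forall r, r < d -> R' r = R r].
Proof.
have neq (r d' : nat) : r < d' -> (r == d') = false by lia.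
elim: e q R d => [r|c|e1 IH1 e2 IH2|e1 IH1 e2 IH2|a e IH|e IH] q R d /=.
- move=> /located_cons[h _] hd hr [h1 [h2 h3 h4] h5 h6].
  rewrite (run_step _ _ _ h) /=; eexists; split; first by rewrite addn1.
  + by rewrite update_eq h1 // h4 addn0.
  + by move=> r' hr'; rewrite /update neq.
- move=> /located_cons[h _] hd _ _.
  rewrite (run_step _ _ _ h) /=; eexists; split; first by rewrite addn1.
  + by rewrite update_eq.
  + by move=> r' hr'; rewrite /update neq.
- move=> /located_cat[h1 /located_cat[h2 /located_cons[h3 _]]] hd /andP[w1 w2] hs.
  have [R1 [r1 v1 f1]] := IH1 _ _ _ h1 hd w1 hs.
  rewrite ?size_code_address size_code_expr in h2 h3.
  have hs1 : simulates s R1 M.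
    by apply: simulates_temp hs _ => r hr; apply: f1; apply: leq_trans hr hd.
  have [R2 [r2 v2 f2]] := IH2 _ _ _ h2 (leqW hd) w2 hs1.
  rewrite ?size_code_address size_code_expr in h3.
  rewrite runD runD r1 r2 (run_step _ _ _ h3) /=; eexists; split.
  + by rewrite addn1 addnS addnA.
  + by rewrite update_eq v2 f2 // v1.
  + by move=> r hr; rewrite /update neq // f2 ?f1 //; apply: ltnW.
- move=> /located_cat[h1 /located_cat[h2 /located_cons[h3 _]]] hd /andP[w1 w2] hs.
  have [R1 [r1 v1 f1]] := IH1 _ _ _ h1 hd w1 hs.
  rewrite ?size_code_address size_code_expr in h2 h3.
  have hs1 : simulates s R1 M.
    by apply: simulates_temp hs _ => r hr; apply: f1; apply: leq_trans hr hd.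
  have [R2 [r2 v2 f2]] := IH2 _ _ _ h2 (leqW hd) w2 hs1.
  rewrite ?size_code_address size_code_expr in h3.
  rewrite runD runD r1 r2 (run_step _ _ _ h3) /=; eexists; split.
  + by rewrite addn1 addnS addnA.
  + by rewrite update_eq v2 f2 // v1.
  + by move=> r hr; rewrite /update neq // f2 ?f1 //; apply: ltnW.
- move=> /located_cat[h1 /located_cat[h2 /located_cons[h3 _]]] hd /andP[w1 w2] hs.
  have [R1 [r1 v1 f1]] := IH _ _ _ h1 hd w2 hs.
  rewrite ?size_code_address size_code_expr in h2 h3.
  have [R2 [r2 v2 f2]] := run_address R1 M h2 hd.
  have [_ [hb _ _] _ h6] := hs.
  rewrite -[7]/(6 + 1) runD r1 runD r2 (run_step _ _ _ h3) /=; eexists; split.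
  + by rewrite !addnS !addn0.
  + by rewrite update_eq v2 f1 ?hb ?h6 ?v1 //; apply: leq_trans hd.
  + by move=> r hr; rewrite /update neq // f2 ?f1.
- move=> /located_cat[h1 /located_cons[h2 /located_cons[h3 /located_cons[h4 _]]]].
  move=> hd w hs.
  have [R1 [r1 v1 f1]] := IH _ _ _ h1 hd w hs.
  rewrite ?size_code_address size_code_expr in h2 h3 h4.
  have [_ [hb _ _] h6 _] := hs.
  have hbd : base < d by apply: leq_trans hd.
  rewrite runD r1 (run_step _ _ _ h2) (run_step _ _ _ h3) (run_step _ _ _ h4) /=.
  eexists; split.
  + by rewrite !addnS !addn0.
  + rewrite /update !eqxx (neq d d.+1) // (f1 base) // hb v1.
    rewrite h6; last by lia.
    have [h|h] := leqP (expr_eval inp s e) n0; first by congr inp; lia.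
    by rewrite (_ : _ - _ = n0); [rewrite !inp0 //; lia | lia].
  + by move=> r hr; rewrite /update (neq r d) // (neq r d.+1) // ?f1 //; lia.
Qed.

(** The last clause is what makes the induction pass through [For]: the body must leave intact the
    counter and bound that enclosing loops keep below [d]. *)
Lemma run_cmd c q s R M d :
  located p q (code c q d) -> temp <= d -> wf c -> simulates s R M ->
  exists R' M', [/\
    run p (time inp c s) (State q R M) = State (q + size (code c q d)) R' M',
    simulates (eval inp c s) R' M' &
    forall r, nvars <= r < d -> R' r = R r].
Proof.
have neq (r d' : nat) : r < d' -> (r == d') = false by lia.
elim: c q s R M d => [|x e|a e1 e2|c1 IH1 c2 IH2|e1 e2 c1 IH1 c2 IH2|x b c IH] q s R M d.
- by move=> _ _ _ hs; exists R, M; rewrite addn0.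
- move=> /= /located_cat[h1 /located_cons[h2 _]] hd /andP[wx we] hs.
  have [R1 [r1 v1 f1]] := run_expr h1 hd we hs.
  rewrite ?size_code_address size_code_expr in h2.
  have hs1 : simulates s R1 M.
    by apply: simulates_temp hs _ => r hr; apply: f1; apply: leq_trans hr hd.
  have [_ [_ _ h0] _ _] := hs1.
  rewrite runD r1 (run_step _ _ _ h2) /= h0 addn0 v1.
  eexists; exists M; split.
  + by rewrite size_cat size_code_expr /= addnA addn1.
  + exact: simulates_set.
  + move=> r /andP[hr1 hr2]; rewrite update_ne ?f1 //.
    by move: hr1 wx; rewrite /nvars; lia.
- move=> /= /located_cat[h1 /located_cat[h2 /located_cat[h3 /located_cons[h4 _]]]].
  move=> hd /and3P[wa w1 w2] hs.
  have [R1 [r1 v1 f1]] := run_expr h1 hd w1 hs.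
  rewrite ?size_code_address size_code_expr in h2 h3 h4.
  have [R2 [r2 v2 f2]] := run_address R1 M h2 hd.
  have hs2 : simulates s R2 M.
    apply: simulates_temp hs _ => r hr; rewrite f2 ?f1 //; exact: leq_trans hr hd.
  have [R3 [r3 v3 f3]] := run_expr h3 (leqW hd) w2 hs2.
  rewrite ?size_code_address size_code_expr /= in h4.
  rewrite !runD r1 r2 r3 (run_step _ _ _ h4) /=.
  exists R3, (update M (R3 d) (R3 d.+1)); split.
  + by rewrite !size_cat size_code_address !size_code_expr /run /=; congr State; lia.
  + have [_ [hb h1' h0'] _ _] := hs.
    have hbd : base < d by apply: leq_trans hd.
    have ea : R3 d = n0 + (8 * expr_eval inp s e1 + a).+1.
      by rewrite f3 // v2 f1 // hb v1.
    rewrite ea v3; have [g1 g2 g3 g4] := hs2.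
    have hR3 r : r < temp -> R3 r = R2 r by move=> hr; apply: f3; apply: leqW (leq_trans hr hd).
    split=> //=.
    * by move=> r hr; rewrite hR3 ?g1 //; rewrite /temp; lia.
    * by rewrite !hR3.
    * by move=> z hz; rewrite update_ne ?g3 //; lia.
    * move=> a' i ha'; rewrite /update.
      case: (eqVneq a' a) => [->|naa]; last first.
        rewrite -g4 //; case: eqP => // eq; case/eqP: naa.
        by move: eq wa ha'; clear; lia.
      case: (eqVneq i (expr_eval inp s e1)) => [->|ni]; first by rewrite eqxx.
      rewrite -g4 //; case: eqP => // eq; case/eqP: ni.
      by move: eq; clear; lia.
  + move=> r /andP[hr1 hr2]; rewrite f3 ?f2 ?f1 //; exact: ltnW.
- move=> /= /located_cat[h1 h2] hd /andP[w1 w2] hs.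
  have [R1 [M1 [r1 s1 f1]]] := IH1 _ _ _ _ _ h1 hd w1 hs.
  have [R2 [M2 [r2 s2 f2]]] := IH2 _ _ _ _ _ h2 hd w2 s1.
  exists R2, M2; rewrite runD r1 r2 size_cat addnA; split=> //.
  by move=> r hr; rewrite f2 ?f1.
- move=> /= /located_cat[h1 /located_cat[h2 /located_cons[h3' /located_cat[h4]]]].
  move=> /located_cons[h5' h6] hd /and4P[we1 we2 w1 w2] hs.
  have [R1 [r1 v1 f1]] := run_expr h1 hd we1 hs.
  rewrite !size_code_expr in h2 h3' h4 h5' h6.
  rewrite -[(_ + expr_size e2).+1]addn1 in h4 h5' h6.
  rewrite -[(_ + size _).+1]addn1 in h6.
  set p2 := code c2 _ d in h3' h4 h5' h6 *.
  set q1 := _ + size p2 + 1 in h3' h5' h6 *.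
  have hs1 : simulates s R1 M.
    by apply: simulates_temp hs _ => r hr; apply: f1; apply: leq_trans hr hd.
  have [R2 [r2 v2 f2]] := run_expr h2 (leqW hd) we2 hs1.
  have hs2 : simulates s R2 M.
    by apply: simulates_temp hs1 _ => r hr; apply: f2; apply: leqW (leq_trans hr hd).
  have f12 r : r < d -> R2 r = R r by move=> hr; rewrite f2 ?f1 //; apply: ltnW.
  rewrite !runD r1 r2 (run_step _ _ _ h3') /= v2 f2 // v1.
  case: ifP => _.
  + have [R3 [M3 [r3 s3 f3]]] := IH1 _ _ _ _ _ h6 hd w1 hs2.
    exists R3, M3; split=> //.
    * rewrite r3 /= !size_cat /= size_cat !size_code_expr /= -/p2 -/q1; congr State.
      by move: (size (code c1 q1 d)) => m; rewrite /q1; lia.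
    * by move=> r hr; rewrite f3 // f12 //; case/andP: hr.
  + have [R3 [M3 [r3 s3 f3]]] := IH2 _ _ _ _ _ h4 hd w2 hs2.
    exists R3, M3; split=> //; last first.
      by move=> r hr; rewrite f3 // f12 //; case/andP: hr.
    rewrite runD -[(_ + expr_size e2).+1]addn1 r3 (run_step _ _ _ h5') /=.
    have [_ [_ -> ->] _ _] := s3; rewrite /=.
    rewrite /= !size_cat /= size_cat !size_code_expr /= -/p2 -/q1; congr State.
    by move: (size (code c1 q1 d)) => m; rewrite /q1; lia.
- move=> /= /located_cons[h1 /located_cons[h2 /located_cons[h3 /located_cons[h4]]]].
  move=> /located_cat[h5 /located_cons[h6 /located_cons[h7 _]]] hd /and3P[wx wb w] hs.
  set m := reg s b; set pc := code c (q + 4) d.+2 in h3 h5 h6 h7 *.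
  rewrite -[q.+4]addn4 in h5 h6 h7.
  have hd1 : one < d by apply: leq_trans hd.
  have hd0 : zero < d by apply: leq_trans hd.
  have hbd : b < d by apply: leq_trans (leq_trans wb _) hd; rewrite /temp; lia.
  pose st j := iteri j (fun j s' => eval inp c (set_reg s' x j)) s.
  pose tm j := \sum_(i < j) (3 + time inp c (set_reg (st i) x i)).
  pose qt := q + 5 + size pc.
  (* The machine is described on arriving at the loop test, at address [qt], with [j] rounds
     completed. *)
  have loop j : j <= m -> exists R' M', [/\
      run p (3 + tm j) (State q R M) = State qt R' M',
      simulates (st j) R' M', R' d = j, R' d.+1 = m &
      forall r, nvars <= r < d -> R' r = R r].
    elim: j => [|j IHj] hj.
      have [g1 [g2 g3 g4] g5 g6] := hs.
      rewrite /tm big_ord0 addn0.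
      rewrite (run_step _ _ _ h1) (run_step _ _ _ h2) (run_step _ _ _ h3) /=.
      eexists; exists M; split.
      - rewrite /update (neq one d) // (neq one d.+1) ?(neq d d.+1) //; last exact: leqW.
        by rewrite !eqxx g3.
      - apply: simulates_temp hs _ => r hr.
        by rewrite /update (neq r d.+1) ?(neq r d) //; lia.
      - by rewrite /update eqxx (neq d d.+1) // eqxx.
      - by rewrite /update !eqxx (neq b d) // g1 // addn0.
      - by move=> r hr; rewrite /update (neq r d.+1) ?(neq r d) //; lia.
    have [R1 [M1 [r1 s1 d1 b1 f1]]] := IHj (ltnW hj).
    have [g1 [g2 g3 g4] g5 g6] := s1.
    have -> : 3 + tm j.+1 = (3 + tm j) + (2 + (time inp c (set_reg (st j) x j) + 1)).
      by rewrite /tm big_ord_recr /=; lia.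
    rewrite [run _ (3 + tm j + _) _]runD r1.
    have h7' : onth p qt = Some (JumpLt d d.+1 (q + 3)).
      by rewrite -h7; congr onth; rewrite /qt; lia.
    rewrite runD (run_step _ _ _ h7') /= d1 b1 hj.
    have h4' : onth p (q + 3) = Some (Add x d zero) by rewrite -h4; congr onth; lia.
    rewrite (run_step _ _ _ h4') /= d1 g4 addn0.
    have s2 := simulates_set j wx s1.
    have [R2 [M2 [r2 s2' f2]]] := IH _ _ _ _ _ h5 (leqW (leqW hd)) w s2.
    have -> : (q + 3).+1 = q + 4 by lia.
    have nx r : nvars <= r -> r != x by move=> hr; move: wx hr; rewrite /nvars; lia.
    have hnd : nvars <= d by apply: leq_trans hd.
    rewrite [run p (2 - 2) _]/= runD r2 (run_step _ _ _ h6) /=.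
    eexists; exists M2; split.
    - by rewrite /qt; congr State; lia.
    - apply: simulates_temp s2' _ => r hr; rewrite /update (neq r d) //; lia.
    - rewrite update_eq !f2 ?update_ne ?nx ?d1 ?g3 ?addn1 //; lia.
    - by rewrite update_ne ?f2 ?update_ne ?nx ?b1 //; lia.
    - move=> r /andP[hr1 hr2]; rewrite update_ne ?f2 ?update_ne ?nx ?f1 //; lia.
  have [R1 [M1 [r1 s1 d1 b1 f1]]] := loop m (leqnn m).
  exists R1, M1; split=> //.
  rewrite -/(tm m) (_ : 4 + tm m = (3 + tm m) + 1); last by lia.
  have h7' : onth p qt = Some (JumpLt d d.+1 (q + 3)).
    by rewrite -h7; congr onth; rewrite /qt; lia.
  rewrite runD r1 (run_step _ _ _ h7') /= d1 b1 ltnn /qt size_cat /=.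
  by congr State; lia.
Qed.

End Simulation.


(** The prologue puts [n * n], the length of the input, into [base] by adding [n] repeatedly, with
    [temp] counting the rounds. The test comes last, so [n = 0] still costs one round; hence
    [maxn 1 n] in the running time. Register [zero] is 0 from the start. *)
Definition compile (c : cmd) : program :=
  [:: Const one 1; Add base base 0; Add temp temp one; JumpLt temp 0 1] ++
  code c 4 temp.

Definition initial_store (args : seq nat) : store := Mk (nth 0 args) (fun _ _ => 0).

Lemma run_compile c n args data :
  wf c -> size args <= nvars -> nth 0 args 0 = n -> size data = n * n ->
  let s := run (compile c)
    (1 + 3 * maxn 1 n + time (nth 0 data) c (initial_store args))
    (initial args data) in
  halted (compile c) s /\
  register s 0 = reg (eval (nth 0 data) c (initial_store args)) 0.
Proof.
move=> wc hargs hn hdata.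
have loc : located (compile c) 0 (compile c) by exists [::], [::]; rewrite cats0.
have [h1 loc1] := located_cons loc; have [h2 loc2] := located_cons loc1.
have [h3 loc3] := located_cons loc2; have [h4 loc4] := located_cons loc3.
pose R0 := nth 0 args.
have R0E r : nvars <= r -> R0 r = 0.
  by move=> hr; rewrite /R0 nth_default //; apply: leq_trans hr.
have loop j : j < maxn 1 n -> exists R', [/\
    run (compile c) (1 + 3 * j) (initial args data) = State 1 R' (nth 0 data),
    R' temp = j, R' base = j * n, R' one = 1 &
    forall r, r < nvars \/ r = zero -> R' r = R0 r].
  elim: j => [|j IHj] hj.
    rewrite (run_step _ _ _ h1) /run /=; eexists; split; first by [].
    - by rewrite update_ne //; apply: R0E.
    - by rewrite update_ne //; apply: R0E.
    - by rewrite update_eq.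
    - by move=> r [hr|->] //; rewrite update_ne // neq_ltn /one ltnS (ltnW hr).
  have [R1 [r1 v1 b1 o1 f1]] := IHj (ltnW hj).
  have R1n : R1 0 = n by rewrite f1 ?hn //; left.
  have -> : 1 + 3 * j.+1 = 1 + 3 * j + 3 by lia.
  rewrite runD r1 (run_step _ _ _ h2) (run_step _ _ _ h3) (run_step _ _ _ h4) /=.
  set R2 := update _ _ _.
  have v2 : R2 temp = j.+1 by rewrite /R2 update_eq !update_ne // v1 o1 addn1.
  have n2 : R2 0 = n by rewrite /R2 !update_ne.
  exists R2; rewrite v2 n2; split=> //.
  - by rewrite ifT //; move: hj; lia.
  - by rewrite /R2 update_ne // update_eq b1 R1n mulSn addnC.
  - move=> r hr; rewrite /R2 !update_ne ?f1 // /base /temp /nvars; move: hr; rewrite /zero /nvars; lia.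
have [R1 [r1 v1 b1 o1 f1]] := loop (maxn 1 n).-1 ltac:(lia).
have R1n : R1 0 = n by rewrite f1 ?hn //; left.
have -> : 1 + 3 * maxn 1 n = 1 + 3 * (maxn 1 n).-1 + 3 by lia.
cbv zeta; rewrite runD runD r1 (run_step _ _ _ h2) (run_step _ _ _ h3) (run_step _ _ _ h4) /=.
set R2 := update _ _ _.
have v2 : R2 temp = maxn 1 n by rewrite /R2 update_eq !update_ne // v1 o1; lia.
have n2 : R2 0 = n by rewrite /R2 !update_ne.
have b2 : R2 base = n * n.
  by rewrite /R2 update_ne // update_eq b1 R1n; case: (n) => [|m] //; rewrite /maxn; case: m => //= m; lia.
rewrite v2 n2 ifF; last by lia.
have inp0 x : n * n <= x -> nth 0 data x = 0 by move=> hx; rewrite nth_default ?hdata.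
have sim : simulates (nth 0 data) (n * n) (initial_store args) R2 (nth 0 data).
  split=> //=.
  - by move=> r hr; rewrite /R2 !update_ne ?f1 //; [left | ..];
      move: hr; rewrite /base /temp /nvars; lia.
  - by split=> //; rewrite /R2 !update_ne // f1 ?R0E //; right.
  - by move=> a i _; apply: inp0; lia.
rewrite /run /= -/(run _ _ _).
have [R3 [M3 [r3 [s3 _ _ _] _]]] := run_cmd inp0 loc4 (leqnn temp) wc sim.
by rewrite r3 /= s3 // /halted /compile size_cat.
Qed.

(** * What a structured program leaves unchanged *)

Fixpoint assigned (c : cmd) : seq nat :=
  match c with
  | Skip | Store _ _ _ => [::]
  | Assign x _ => [:: x]
  | Seq c1 c2 | If _ _ c1 c2 => assigned c1 ++ assigned c2
  | For x _ c => x :: assigned c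
  end.

Fixpoint stored (c : cmd) : seq nat :=
  match c with
  | Skip | Assign _ _ => [::]
  | Store a _ _ => [:: a]
  | Seq c1 c2 | If _ _ c1 c2 => stored c1 ++ stored c2
  | For _ _ c => stored c
  end.

Section Frame.
Variable inp : nat -> nat.

Lemma eval_seq c1 c2 s : eval inp (Seq c1 c2) s = eval inp c2 (eval inp c1 s).
Proof. by []. Qed.

Lemma eval_assign x e s : eval inp (Assign x e) s = set_reg s x (expr_eval inp s e).
Proof. by []. Qed.

Lemma eval_if e1 e2 c1 c2 s : eval inp (If e1 e2 c1 c2) s =
  if expr_eval inp s e1 < expr_eval inp s e2 then eval inp c1 s else eval inp c2 s.
Proof. by []. Qed.

Lemma iteri_ind (T : Type) (P : nat -> T -> Prop) f (x : T) m :
  P 0 x -> (forall j y, j < m -> P j y -> P j.+1 (f j y)) -> P m (iteri m f x).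
Proof.
move=> P0 PS; have: m <= m by []; elim: {-2}m => //= j IH hj.
by apply: PS => //; apply: IH; apply: ltnW.
Qed.

Lemma frame_reg c s r : r \notin assigned c -> reg (eval inp c s) r = reg s r.
Proof.
elim: c s => [|x e|a e1 e2|c1 IH1 c2 IH2|e1 e2 c1 IH1 c2 IH2|x b c IH] s //=.
- by rewrite inE /update => /negbTE ->.
- by rewrite mem_cat negb_or => /andP[h1 h2]; rewrite IH2 ?IH1.
- by rewrite mem_cat negb_or => /andP[h1 h2]; case: ifP; rewrite ?IH2 ?IH1.
rewrite inE negb_or => /andP[/negbTE rx h].
apply: (@iteri_ind _ (fun _ s' => reg s' r = reg s r)) => // j s' _ <-.
by rewrite IH //= /update rx.
Qed.

Lemma frame_arr c s a : a \notin stored c -> arr (eval inp c s) a = arr s a.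
Proof.
elim: c s => [|x e|a' e1 e2|c1 IH1 c2 IH2|e1 e2 c1 IH1 c2 IH2|x b c IH] s //=.
- by rewrite inE => /negbTE ->.
- by rewrite mem_cat negb_or => /andP[h1 h2]; rewrite IH2 ?IH1.
- by rewrite mem_cat negb_or => /andP[h1 h2]; case: ifP; rewrite ?IH2 ?IH1.
move=> h; apply: (@iteri_ind _ (fun _ s' => arr s' a = arr s a)) => // j s' _ <-.
by rewrite IH.
Qed.

(** Each round may also use that whatever the body does not write still has its value from before
    the loop, so invariants need to mention only what changes. *)
Lemma for_ind (I : nat -> store -> Prop) x b c s :
  I 0 s ->
  (forall j s', j < reg s b ->
     (forall r, r \notin x :: assigned c -> reg s' r = reg s r) ->
     (forall a, a \notin stored c -> arr s' a = arr s a) ->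
     I j s' -> I j.+1 (eval inp c (set_reg s' x j))) ->
  I (reg s b) (eval inp (For x b c) s).
Proof.
move=> I0 IS /=.
pose J j s' := [/\ I j s', forall r, r \notin x :: assigned c -> reg s' r = reg s r &
  forall a, a \notin stored c -> arr s' a = arr s a].
suff [] : J (reg s b) (iteri (reg s b) (fun j s' => eval inp c (set_reg s' x j)) s) by [].
apply: iteri_ind => // j s' hj [h1 h2 h3]; split; first exact: IS.
  move=> r hr; rewrite frame_reg; last by move: hr; rewrite inE negb_or => /andP[].
  by rewrite /= /update; move: (hr); rewrite inE negb_or => /andP[/negbTE -> _]; apply: h2.
by move=> a ha; rewrite frame_arr //= h3.
Qed.

End Frame.


(** * The algorithm *)

(* [rstate] is the number of the current state, [rtarget] the common end-vertex,
   [rbest] the first vertex in topological order that holds an unfinished token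
   and [rtoken] the token moved from there.  A move is allowed if [rblock] is 0
   and the multiplicity of its arc is at least [rneed]; it leads to the state
   [rnext].  [rsum] and [rlsum] are the sums of the [aW] and [aLW] entries. *)
Notation rn := 0 (only parsing).
Notation rk := 1 (only parsing).
Notation rl := 2 (only parsing).
Notation racc := 3 (only parsing).
Notation rround := 4 (only parsing).
Notation rvertex := 5 (only parsing).
Notation rbad := 6 (only parsing).
Notation rother := 7 (only parsing).
Notation rsel := 8 (only parsing).
Notation rweight := 9 (only parsing).
Notation rlweight := 10 (only parsing).
Notation rsum := 11 (only parsing).
Notation rlsum := 12 (only parsing).
Notation rtotal := 13 (only parsing).
Notation rtarget := 14 (only parsing).
Notation rstate := 15 (only parsing).
Notation rbest := 16 (only parsing).
Notation rtoken := 17 (only parsing).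
Notation rwin := 18 (only parsing).
Notation rcount := 19 (only parsing).
Notation rnext := 20 (only parsing).
Notation rblock := 21 (only parsing).
Notation rneed := 22 (only parsing).
Notation rborrow := 23 (only parsing).
Notation rindex := 24 (only parsing).
Notation rstep := 25 (only parsing).
Notation rstart := 26 (only parsing).
Notation rcounter := 27 (only parsing).

(* [aord] lists the vertices in topological order and [amul] the multiples of
   [n].  Token [j] stands at position [aP j] of that order with counter [aC j],
   and [aW], [aLW] hold the weights [B ^ j] and [l * B ^ j], where [B = n * l].
   [aT] is the table of winning states. *)
Notation amark := 0 (only parsing).
Notation amul := 1 (only parsing).
Notation aord := 2 (only parsing).
Notation aW := 3 (only parsing).
Notation aLW := 4 (only parsing).
Notation aP := 5 (only parsing).
Notation aC := 6 (only parsing).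
Notation aT := 7 (only parsing).

(** * Topological sorting *)

Definition mul_table : cmd :=
  Seq (Assign rweight (Num 0))
      (For rvertex rn (Seq (Store amul (Var rvertex) (Var rweight)) (Assign rweight (Plus (Var rweight) (Var rn))))).

(** Starting [rbad] at the vertex's own mark also rejects vertices that are already sorted. *)
Definition check_source : cmd :=
  Seq (Assign rbad (Cell amark (Var rvertex)))
      (For rother rn
         (If (Cell amark (Var rother)) (Num 1)
             (If (Num 0) (Input (Plus (Cell amul (Var rother)) (Var rvertex))) (Assign rbad (Num 1)) Skip)
             Skip)).

(** The loop cannot be left early; [rsel] keeps the last source found. *)
Definition find_source : cmd :=
  For rvertex rn (Seq check_source (If (Var rbad) (Num 1) (Assign rsel (Var rvertex)) Skip)).

Definition sort_vertices : cmd :=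
  Seq mul_table
      (For rround rn (Seq find_source
         (Seq (Store amark (Var rsel) (Num 1)) (Store aord (Var rround) (Var rsel))))).

Section Sort.
Variables (inp : nat -> nat) (n : nat).
Implicit Types s : store.

Lemma mul_tableP s : reg s rn = n ->
  forall i, i < n -> arr (eval inp mul_table s) amul i = i * n.
Proof.
move=> hn; rewrite eval_seq eval_assign.
set s0 := set_reg _ _ _.
have hn0 : reg s0 rn = n by [].
have := @for_ind inp (fun j s' => reg s' rweight = j * n /\ forall i, i < j -> arr s' amul i = i * n)
  rvertex rn _ s0.
rewrite hn0 => /(_ (Seq (Store amul (Var rvertex) (Var rweight)) (Assign rweight (Plus (Var rweight) (Var rn)))))[].
- by [].
- move=> j s' hj hr _ [h1 h2] /=; have e : reg s' rn = n by rewrite hr.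
  rewrite /update /= h1 e; split; first by rewrite mulSn addnC.
  by move=> i; rewrite ltnS leq_eqVlt; case: eqP => [-> //|_ /h2].
by [].
Qed.

Lemma check_sourceP s : reg s rn = n -> (forall i, i < n -> arr s amul i = i * n) ->
  reg (eval inp check_source s) rbad = 0 <->
  arr s amark (reg s rvertex) = 0 /\
  forall y, y < n -> arr s amark y = 0 -> inp (y * n + reg s rvertex) = 0.
Proof.
move=> hn hmul; rewrite eval_seq eval_assign.
set s0 := set_reg _ _ _; set x := reg s rvertex.
have hn0 : reg s0 rn = n by [].
rewrite /check_source; set c := If _ _ _ _.
have := @for_ind inp (fun j s' => reg s' rbad = 0 <-> arr s amark x = 0 /\
  forall y, y < j -> arr s amark y = 0 -> inp (y * n + x) = 0) rother rn c s0.
rewrite hn0; apply.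
  by rewrite /= /update /=; split=> [-> //|[]].
move=> j s' hj hr ha h; rewrite /c /=.
have -> : arr s' amark = arr s amark by rewrite ha.
have -> : arr s' amul = arr s amul by rewrite ha.
have ex : reg s' rvertex = x by rewrite hr.
rewrite /update /= ex hmul //.
have split_j : (forall y, y < j.+1 -> arr s amark y = 0 -> inp (y * n + x) = 0) <->
   (forall y, y < j -> arr s amark y = 0 -> inp (y * n + x) = 0) /\
   (arr s amark j = 0 -> inp (j * n + x) = 0).
  split=> [g|[g1 g2] y]; first by split=> [y /ltnW|]; apply: g.
  by rewrite ltnS leq_eqVlt => /orP[/eqP ->|/g1].
rewrite split_j; case: ltnP => hm.
  have m0 : arr s amark j = 0 by lia.
  case: ltnP => hi /=; first by split=> // -[_ [_ /(_ m0)]]; lia.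
  by rewrite /update /= h; split=> [[h1 h2]|[h1 [h2 _]]]; split=> //; split=> //; lia.
by rewrite /= h; split=> [[h1 h2]|[h1 [h2 _]]]; split=> //; split=> //; lia.
Qed.

Lemma find_sourceP s : reg s rn = n -> (forall i, i < n -> arr s amul i = i * n) ->
  let good x := arr s amark x = 0 /\
    forall y, y < n -> arr s amark y = 0 -> inp (y * n + x) = 0 in
  (exists2 x, x < n & good x) ->
  let x := reg (eval inp find_source s) rsel in x < n /\ good x.
Proof.
move=> hn hmul good [x0 hx0 gx0].
have := @for_ind inp (fun j s' => (exists2 x, x < j & good x) ->
  reg s' rsel < n /\ good (reg s' rsel)) rvertex rn
  (Seq check_source (If (Var rbad) (Num 1) (Assign rsel (Var rvertex)) Skip)) s.
rewrite hn => /(_ _ _ (ex_intro2 _ _ x0 hx0 gx0)); apply; first by case.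
move=> j s' hj hr ha h [x xj gx].
set s1 := set_reg s' rvertex j.
have hn1 : reg s1 rn = n by rewrite -hn -hr.
have mark1 : arr s1 amark = arr s amark by rewrite -ha.
have mul1 : arr s1 amul = arr s amul by rewrite -ha.
have := check_sourceP hn1; rewrite mul1 mark1 => /(_ hmul) hc.
rewrite eval_seq; set s2 := eval inp check_source s1 in hc *.
have sel2 : reg s2 rsel = reg s' rsel by rewrite frame_reg.
have x2 : reg s2 rvertex = j by rewrite frame_reg.
rewrite /=; case: (ltnP (reg s2 rbad) 1) => hb; rewrite ?/update /= ?x2.
  by split=> //; apply: (proj1 hc); move: hb => /=; lia.
rewrite sel2; apply: h; move: xj; rewrite ltnS leq_eqVlt => /orP[/eqP exj|xj].
  have gj : good j by rewrite -exj.
  by have := proj2 hc gj; move: hb => /=; lia.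
by exists x.
Qed.

(** The last hypothesis is acyclicity as the algorithm uses it, applied to the set of unsorted
    vertices. The loop invariant records that all in-neighbours of a listed vertex are listed before
    it, which gives the final clause. *)
Lemma sort_verticesP s : reg s rn = n -> arr s amark =1 (fun=> 0) ->
  (forall U : pred nat, (exists2 x, x < n & U x) ->
     exists2 x, x < n & U x /\ forall y, y < n -> U y -> inp (y * n + x) = 0) ->
  let s' := eval inp sort_vertices s in
  [/\ forall i, i < n -> arr s' amul i = i * n,
      forall i, i < n -> arr s' aord i < n,
      forall i j, i < n -> j < n -> arr s' aord i = arr s' aord j -> i = j &
      forall i j, i < n -> j < n -> 0 < inp (arr s' aord i * n + arr s' aord j) -> i < j].
Proof.
move=> hn mark0 hU; rewrite /sort_vertices.
have := @eval_seq inp mul_table; move=> ->.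
set s0 := eval inp mul_table s; set body := Seq find_source _.
have hn0 : reg s0 rn = n by rewrite frame_reg.
have mul0 : forall i, i < n -> arr s0 amul i = i * n by apply: mul_tableP.
have mark00 : arr s0 amark =1 (fun=> 0) by rewrite /s0 frame_arr.
have := @for_ind inp (fun r s' => let O := mkseq (arr s' aord) r in
  [/\ uniq O, all (fun x => x < n) O, forall x, x < n -> (arr s' amark x != 0) = (x \in O) &
    forall r', r' < r -> forall y, y < n -> 0 < inp (y * n + arr s' aord r') ->
      y \in mkseq (arr s' aord) r']) rround rn body s0.
rewrite hn0; case=> //.
- by split=> // x _; rewrite mark00.
- move=> r s' hr fr fa [Ouniq Olt Omark Oin].
  rewrite /body eval_seq.
  set s1 := set_reg s' rround r.
  have hn1 : reg s1 rn = n by rewrite -hn0 -fr.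
  have mul1 i : i < n -> arr s1 amul i = i * n by rewrite /= fa //; apply: mul0.
  set s2 := eval inp find_source s1.
  have ord2 : arr s2 aord = arr s' aord by rewrite frame_arr.
  have mark2 : arr s2 amark = arr s' amark by rewrite frame_arr.
  have r2 : reg s2 rround = r by rewrite frame_reg.
  have ex : exists2 x, x < n & x \notin mkseq (arr s' aord) r.
    have [/allP all_in|/allPn[x]] := boolP (all (mem (mkseq (arr s' aord) r)) (iota 0 n)).
      have := uniq_leq_size (iota_uniq 0 n) all_in; rewrite size_mkseq size_iota; lia.
    by rewrite mem_iota /=; exists x.
  have fs := find_sourceP hn1 mul1; rewrite -/s2 /= in fs.
  have [|sel_n [sel_mark sel_src]] := fs _.
    have [x xn [hx1 hx2]] := hU (fun x => x \notin mkseq (arr s' aord) r) ex.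
    exists x => //; split=> [|y yn ym]; first by apply/eqP; move: hx1; rewrite -Omark // negbK.
    by apply: hx2 => //; rewrite -Omark // ym.
  set x := reg s2 rsel in sel_n sel_mark sel_src *.
  set s3 := eval _ _ s2.
  have -> : arr s3 aord = update (arr s' aord) r x by rewrite /s3 /= r2 ord2.
  have -> : arr s3 amark = update (arr s' amark) x 1 by rewrite /s3 /= mark2.
  have Oeq m : m <= r -> mkseq (update (arr s' aord) r x) m = mkseq (arr s' aord) m.
    move=> hm; apply/eq_in_map => i; rewrite mem_iota /= /update => hi.
    by rewrite ltn_eqF //; apply: leq_trans hm.
  have Or : mkseq (update (arr s' aord) r x) r.+1 = rcons (mkseq (arr s' aord) r) x.
    by rewrite mkseqS Oeq // update_eq.
  have xO : x \notin mkseq (arr s' aord) r by rewrite -Omark // sel_mark.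
  rewrite Or; split.
  + by rewrite rcons_uniq xO.
  + by rewrite all_rcons sel_n.
  + move=> y yn; rewrite /update mem_rcons inE -Omark //.
    by case: (y == x).
  + move=> r'; rewrite ltnS leq_eqVlt => /orP[/eqP ->|hr'] y yn.
      rewrite update_eq Oeq // => hy; rewrite -Omark //; apply/eqP => /(sel_src y yn); lia.
    rewrite /update (ltn_eqF hr') -/(update _ _ _) Oeq ?(ltnW hr') //.
    exact: Oin.
move=> Ouniq Olt Omark Oin.
have /mkseq_uniqP inj := Ouniq.
have olt i : i < n -> arr (eval inp (For rround rn body) s0) aord i < n.
  by move=> hi; apply: (allP Olt); apply/mapP; exists i; rewrite ?mem_iota.
split=> //.
- move=> i hi; rewrite frame_arr //; exact: mul0.
- move=> i j hi hj /(Oin j hj _ (olt i hi)) /mapP[i']; rewrite mem_iota /= => hi' e.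
  by rewrite (inj i i' hi _ e) //; apply: ltn_trans hj.
Qed.

End Sort.

(** Take a vertex of [U] that the fewest vertices can reach. Given an arc from [y] in [U] to [x],
    whatever reaches [y] reaches [x], while [x] itself does not reach [y] without closing a cycle;
    so [y] would have fewer. *)
Lemma acyclic_source (G : digraph) (U : {set vertices G}) x0 :
  acyclic G -> x0 \in U ->
  exists2 x, x \in U & forall y, y \in U -> multiplicity y x = 0.
Proof.
move=> acyc x0U.
have [x xU xmin] := @arg_minnP _ x0 (mem U)
  (fun x => #|[set y | connect (@adjacent G) y x]|) x0U.
exists x => // y yU; case: (posnP (multiplicity y x)) => // adj_yx.
have: #|[set z | connect (@adjacent G) z y]| < #|[set z | connect (@adjacent G) z x]|.
  apply/proper_card/properP; split.
    apply/subsetP => z; rewrite !inE => h; apply: connect_trans h _.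
    exact: connect1.
  exists x; rewrite !inE ?connect0 //.
  apply/negP => /connectP[p px py]; case/shortenP: px py => p' px' uniq_p' _ py.
  have := acyc (x :: p'); rewrite /ucycle uniq_p' /= rcons_path px' -py [adjacent _ _]adj_yx.
  by move=> /(_ isT).
by rewrite ltnNge xmin.
Qed.

Lemma routable_ext A v k p c p' c' :
  (forall j, j < k -> p j = p' j) -> (forall j, j < k -> c j = c' j) ->
  routable A v k p c -> routable A v k p' c'.
Proof.
move=> ep ec [q [qP qc qd qx]]; exists q; split.
- by move=> i hi; rewrite -ep //; apply: qP.
- by move=> i hi; rewrite -ep // -ec //; apply: qc.
- move=> i hi hs; rewrite -ep //; have := qd i hi hs.
  by rewrite big_nat (eq_bigr (fun j => p' j == p i : nat)) -?big_nat // => j /andP[_ /ep ->].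
by move=> i j x hi hj; rewrite -ep //; apply: qx.
Qed.

(** * Powers of the base by repeated addition *)

Definition add_times (x b r e : nat) : cmd :=
  For x b (Assign r (Plus (Var r) (Var e))).

Lemma add_timesP inp x b r e s : uniq [:: x; r; e] ->
  reg (eval inp (add_times x b r e) s) r = reg s r + reg s b * reg s e.
Proof.
rewrite /add_times => u; have : (x != r) && (x != e) && (r != e).
  by move: u; rewrite /= !inE negb_or andbT.
move=> {u} /andP[/andP[xr xe] re].
apply: (@for_ind inp (fun j s' => reg s' r = reg s r + j * reg s e)) => [|j s' hj fr _ h].
  by rewrite addn0.
have e' : reg s' e = reg s e by rewrite fr //= !inE negb_or ![e == _]eq_sym xe re.
by rewrite /= /update eqxx [r == x]eq_sym [e == x]eq_sym (negbTE xr) (negbTE xe) h e'; lia.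
Qed.

Definition weights_body : cmd :=
  Seq (Store aW (Var rindex) (Var rweight)) (
  Seq (Assign rlweight (Num 0)) (
  Seq (add_times rcounter rl rlweight rweight) (
  Seq (Store aLW (Var rindex) (Var rlweight)) (
  Seq (Assign rsum (Plus (Var rsum) (Var rweight))) (
  Seq (Assign rlsum (Plus (Var rlsum) (Var rlweight))) (
  Seq (Assign rweight (Num 0)) (
  add_times rcounter rn rweight rlweight))))))).

Definition weights : cmd :=
  Seq (Assign rweight (Num 1)) (
  Seq (Assign rsum (Num 0)) (
  Seq (Assign rlsum (Num 0)) (
  Seq (For rindex rk weights_body)
      (Assign rtotal (Var rweight))))).

Lemma weightsP inp s n k l : reg s rn = n -> reg s rk = k -> reg s rl = l ->
  let s' := eval inp weights s in
  [/\ forall j, j < k -> arr s' aW j = (n * l) ^ j /\ arr s' aLW j = l * (n * l) ^ j,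
      reg s' rsum = \sum_(j < k) (n * l) ^ j,
      reg s' rlsum = \sum_(j < k) l * (n * l) ^ j &
      reg s' rtotal = (n * l) ^ k].
Proof.
move=> hn hk hl; cbv zeta; rewrite /weights 3!eval_seq 3!eval_assign eval_seq.
set s0 := set_reg _ rlsum _.
have := @for_ind inp (fun m s' =>
  [/\ forall j, j < m -> arr s' aW j = (n * l) ^ j /\ arr s' aLW j = l * (n * l) ^ j,
      reg s' rsum = \sum_(j < m) (n * l) ^ j,
      reg s' rlsum = \sum_(j < m) l * (n * l) ^ j &
      reg s' rweight = (n * l) ^ m]) rindex rk weights_body s0.
rewrite [reg s0 rk]hk; case=> //.
- by split=> //; rewrite big_ord0.
- move=> j s' hj fr _ [h1 h2 h3 h4].
  have n' : reg s' rn = n by rewrite fr.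
  have l' : reg s' rl = l by rewrite fr.
  rewrite /weights_body 2!eval_seq eval_assign eval_seq.
  set s1 := set_reg _ rlweight _; set s2 := eval inp (add_times _ _ _ _) s1.
  have lw2 : reg s2 rlweight = l * (n * l) ^ j.
    by rewrite add_timesP // /s1 /= /update /= h4 l'.
  have fr2 r : r \notin [:: rlweight; rcounter] -> reg s2 r = reg s1 r.
    by move=> hr; rewrite frame_reg //=; move: hr; rewrite !inE orbC.
  have fa2 a : arr s2 a = arr s1 a by rewrite frame_arr.
  rewrite 4!eval_seq; set s3 := eval inp (Assign rweight _) _.
  have e3 : [/\ reg s3 rsum = reg s' rsum + reg s' rweight, reg s3 rlsum = reg s' rlsum + reg s2 rlweight,
      reg s3 rlweight = reg s2 rlweight & reg s3 rweight = 0].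
    by split; rewrite /s3 /= /update /= ?(fr2 rsum) ?(fr2 rlsum) ?(fr2 rweight).
  case: e3 => e31 e32 e33 e34.
  have n3 : reg s3 rn = n by rewrite -n' /s3 /= /update /= fr2.
  set s4 := eval inp _ s3.
  have w4 : reg s4 rweight = (n * l) ^ j.+1.
    by rewrite /s4 add_timesP // e34 e33 lw2 n3 expnS mulnA.
  have fr4 r : r \notin [:: rweight; rcounter] -> reg s4 r = reg s3 r.
    by move=> hr; rewrite frame_reg //=; move: hr; rewrite !inE orbC.
  have fa4 a : arr s4 a = arr s3 a by rewrite frame_arr.
  split=> //.
  + move=> i; rewrite !fa4 /s3 /= !fa2 fr2 // lw2 /s1 /= /update /=.
    by rewrite ltnS leq_eqVlt; case: eqP => [-> _|_ /h1].
  + by rewrite fr4 // e31 h2 h4 big_ord_recr.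
  + by rewrite fr4 // e32 h3 lw2 big_ord_recr.
Qed.

Definition If_eq (e1 e2 : expr) (c1 c2 : cmd) : cmd :=
  If (Plus (Minus e1 e2) (Minus e2 e1)) (Num 1) c1 c2.

(** Both truncated differences vanish exactly for equal values, which reduces equality to the only
    available test. *)
Lemma eval_if_eq inp e1 e2 c1 c2 s :
  eval inp (If_eq e1 e2 c1 c2) s =
  if expr_eval inp s e1 == expr_eval inp s e2 then eval inp c1 s else eval inp c2 s.
Proof. by rewrite /=; congr (if _ then _ else _); lia. Qed.

Definition arc_entry (x y : nat) : expr :=
  Input (Plus (Cell amul (Cell aord (Var x))) (Cell aord (Var y))).

Definition init_tokens : cmd :=
  For rindex rk (Seq (Store aP (Var rindex) (Minus (Var rn) (Num 1)))
                 (Store aC (Var rindex) (Minus (Var rl) (Num 1)))).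

(** The strict comparison with [rbest] keeps the least index among tokens at the same vertex. *)
Definition scan_body : cmd :=
  If (Cell aP (Var rindex)) (Var rbest)
    (If_eq (Cell aP (Var rindex)) (Var rtarget) Skip
       (Seq (Assign rbest (Cell aP (Var rindex))) (Assign rtoken (Var rindex))))
    Skip.

Definition scan : cmd := Seq (Assign rbest (Var rn)) (For rindex rk scan_body).

Definition count_at (dst src : nat) : cmd :=
  Seq (Assign dst (Num 0))
    (For rindex rk (If_eq (Cell aP (Var rindex)) (Var src) (Assign dst (Plus (Var dst) (Num 1))) Skip)).

(** The two cases of [movable] share one test: [rblock] is the number of tokens at the head, or the
    remaining counter if the head is the target; [rneed] is 1, or the number of tokens at the tail.
    Each vertex beyond [rbest] adds [l * B ^ i] to [rnext]. *)
Definition try_move : cmd :=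
  If (Var rbest) (Var rvertex)
    (Seq (Assign rnext (Plus (Var rnext) (Cell aLW (Var rtoken))))
    (Seq (count_at rblock rvertex)
    (Seq (Assign rneed (Num 1))
    (Seq (If_eq (Var rvertex) (Var rtarget) (Seq (Assign rblock (Var rcounter)) (Assign rneed (Var rcount))) Skip)
    (If (Var rblock) (Num 1)
      (If (Var rneed) (Plus (arc_entry rbest rvertex) (Num 1))
        (If (Num 0) (Cell aT (Var rnext)) (Assign rwin (Num 1)) Skip) Skip) Skip)))))
    Skip.

Definition try_moves : cmd :=
  Seq (Assign rwin (Num 0))
  (Seq (count_at rcount rbest)
  (Seq (Assign rcounter (Cell aC (Var rtoken)))
  (Seq (Assign rnext (Var rstate))
  (Seq (If (Num 0) (Var rcounter) (Assign rnext (Minus (Var rstate) (Cell aW (Var rtoken)))) Skip)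
  (For rvertex rn try_move))))).

(** One wheel of an odometer: the counter is the low part of the digit and the position its high
    part, and both wrap to their maxima when a borrow is passed on. *)
Definition decrement_body : cmd :=
  If (Num 0) (Var rborrow)
    (If (Num 0) (Cell aC (Var rindex))
      (Seq (Store aC (Var rindex) (Minus (Cell aC (Var rindex)) (Num 1))) (Assign rborrow (Num 0)))
      (Seq (Store aC (Var rindex) (Minus (Var rl) (Num 1)))
        (If (Num 0) (Cell aP (Var rindex))
          (Seq (Store aP (Var rindex) (Minus (Cell aP (Var rindex)) (Num 1))) (Assign rborrow (Num 0)))
          (Store aP (Var rindex) (Minus (Var rn) (Num 1))))))
    Skip.

Definition decrement : cmd := Seq (Assign rborrow (Num 1)) (For rindex rk decrement_body).

Definition process_state : cmd :=
  Seq (Assign rstate (Minus (Var rstate) (Num 1)))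
  (Seq scan
  (Seq (If (Var rbest) (Var rn) try_moves (Assign rwin (Num 1)))
  (Seq (Store aT (Var rstate) (Var rwin))
  decrement))).

(** [rlsum - rsum] is the number of the state with all tokens at position 0 and all counters [l.-1];
    shifting all tokens by one position adds [rlsum]. *)
Definition query : cmd :=
  Seq (Assign rnext (Minus (Var rlsum) (Var rsum)))
    (For rstart rn
      (Seq (If (Var rstart) (Var rtarget)
             (If (Num 0) (Cell aT (Var rnext)) (Assign racc (Num 1)) Skip) Skip)
           (Assign rnext (Plus (Var rnext) (Var rlsum))))).

Definition solve_target : cmd :=
  Seq init_tokens (Seq (Assign rstate (Var rtotal)) (Seq (For rstep rtotal process_state) query)).

Definition solve : cmd := For rtarget rn solve_target.

(** * Correctness of the search *)

Section Search.
Variables (inp : nat -> nat) (n k l : nat) (A : nat -> nat -> nat).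
Hypotheses (n_gt0 : 0 < n) (k_gt0 : 0 < k) (l_gt0 : 0 < l).
Let B := n * l.
Implicit Types s : store.

(** These data are computed once, before the search. That a command preserves them is decided by
    [harmless], so it is mostly proved by computation. *)
Definition ready s : Prop :=
  [/\ [/\ reg s rn = n, reg s rk = k & reg s rl = l],
      forall x y, x < n -> y < n -> inp (arr s amul (arr s aord x) + arr s aord y) = A x y,
      forall j, j < k -> arr s aW j = B ^ j /\ arr s aLW j = l * B ^ j &
      [/\ reg s rsum = \sum_(j < k) B ^ j, reg s rlsum = \sum_(j < k) l * B ^ j &
          reg s rtotal = B ^ k]].

Lemma ready_frame s s' :
  (forall r, r \in [:: rn; rk; rl; rsum; rlsum; rtotal] -> reg s' r = reg s r) ->
  (forall a, a \in [:: amul; aord; aW; aLW] -> arr s' a = arr s a) ->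
  ready s -> ready s'.
Proof. by move=> fr fa; rewrite /ready !fr ?fa. Qed.

Definition harmless (c : cmd) : bool :=
  all (fun r => r \notin assigned c) [:: rn; rk; rl; rsum; rlsum; rtotal] &&
  all (fun a => a \notin stored c) [:: amul; aord; aW; aLW].

Lemma ready_eval c s : harmless c -> ready s -> ready (eval inp c s).
Proof.
move=> /andP[/allP hr /allP ha]; apply: ready_frame => [r /hr|a /ha] h.
  exact: frame_reg.
exact: frame_arr.
Qed.

Lemma for_ready (I : nat -> store -> Prop) x b c s m :
  harmless (For x b c) -> ready s -> reg s b = m -> I 0 s ->
  (forall j s', j < m ->
     (forall r, r \notin x :: assigned c -> reg s' r = reg s r) ->
     (forall a, a \notin stored c -> arr s' a = arr s a) ->
     ready s' -> I j s' -> I j.+1 (eval inp c (set_reg s' x j))) ->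
  I m (eval inp (For x b c) s).
Proof.
move=> /andP[/allP hr /allP ha] rs <- I0 IS; apply: for_ind => // j s' hj fr fa.
by apply: IS => //; apply: ready_frame rs => [r /hr/fr|a /ha/fa].
Qed.

Lemma init_tokensP s : ready s ->
  forall j, j < k -> arr (eval inp init_tokens s) aP j = n.-1 /\
                     arr (eval inp init_tokens s) aC j = l.-1.
Proof.
move=> rs; apply: (for_ready (I := fun m s' => forall j, j < m ->
  arr s' aP j = n.-1 /\ arr s' aC j = l.-1)) => //; first by case: rs => -[].
move=> j s' hj fr _ rs' h i; have [[n' _ l'] _ _ _] := rs'.
rewrite /= /update /= n' l' !subn1 ltnS leq_eqVlt.
by case: eqP => [->|_ /h].
Qed.

Lemma scanP s : ready s -> (forall j, j < k -> arr s aP j < n) ->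
  let s' := eval inp scan s in let p := arr s aP in let v := reg s rtarget in
  (reg s' rbest = n /\ forall j, j < k -> p j = v) \/
  [/\ reg s' rtoken < k, p (reg s' rtoken) != v, reg s' rbest = p (reg s' rtoken),
      forall j, j < k -> p j != v -> p (reg s' rtoken) <= p j &
      forall j, j < reg s' rtoken -> p j != v -> p (reg s' rtoken) < p j].
Proof.
move=> rs pn; set p := arr s aP; set v := reg s rtarget; cbv zeta.
rewrite /scan eval_seq eval_assign; set s0 := set_reg _ _ _.
have rs0 : ready s0 by exact: rs.
apply: (for_ready (I := fun m s' =>
  (reg s' rbest = n /\ forall j, j < m -> p j = v) \/
  [/\ reg s' rtoken < m, p (reg s' rtoken) != v, reg s' rbest = p (reg s' rtoken),
      forall j, j < m -> p j != v -> p (reg s' rtoken) <= p j &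
      forall j, j < reg s' rtoken -> p j != v -> p (reg s' rtoken) < p j])) => //.
- by case: rs => -[].
- by left; split=> //; rewrite /s0 /= /update /=; case: rs => -[].
move=> j s' hj fr fa rs' h; rewrite /scan_body.
have v' : reg s' rtarget = v by rewrite fr.
have p' : arr s' aP = p by rewrite fa.
have pj := pn j hj; rewrite -/p in pj.
have lt_split i : i < j.+1 -> i < j \/ i = j by lia.
rewrite /= /update /= p' v'.
have -> : (p j - v + (v - p j) < 1) = (p j == v) by lia.
case: ltnP => hb; last first.
  case: h => [[h1 h2]|[h1 h2 h3 h4 h5]]; first by move: hb; rewrite h1; lia.
  right; rewrite /= /update /=; split=> //; first exact: ltnW.
  by move=> i /lt_split[|->] //; [apply: h4 | rewrite -h3].
case: eqP => hv.
  case: h => [[h1 h2]|[h1 h2 h3 h4 h5]]; rewrite /= /update /=.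
    by left; split=> // i /lt_split[/h2|->].
  right; split=> //; first exact: ltnW.
  by move=> i /lt_split[|->] //; [apply: h4 | rewrite hv eqxx].
right; rewrite /= /update /=; split=> //; first exact/eqP.
  case: h => [[h1 h2]|[h1 h2 h3 h4 h5]] i /lt_split[hi|->] // niv.
    by rewrite h2 ?eqxx in niv.
  by apply: ltnW; apply: leq_trans (h4 _ hi niv); rewrite -h3.
move=> i hi niv; case: h => [[h1 h2]|[h1 h2 h3 h4 h5]].
  by rewrite h2 ?eqxx in niv.
by apply: leq_trans (h4 _ hi niv); rewrite -h3.
Qed.

Lemma count_atP dst src s : ready s ->
  dst \notin [:: rn; rk; rl; rsum; rlsum; rtotal; rindex; src] -> src != rindex ->
  reg (eval inp (count_at dst src) s) dst = \sum_(j < k) (arr s aP j == reg s src).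
Proof.
move=> rs dst_ok nsj.
have hd r : r \in [:: rn; rk; rl; rsum; rlsum; rtotal] -> r != dst.
  by move=> hr; apply: contraNneq dst_ok => <-; move: hr; rewrite !inE => /or3P[||/or4P[]] ->; rewrite ?orbT.
have [dj ds] : dst != rindex /\ dst != src.
  by move: dst_ok; rewrite !inE !negb_or; do 6![case/andP=> _]; case/andP.
rewrite /count_at eval_seq eval_assign; set s0 := set_reg _ _ _.
have rs0 : ready s0.
  by apply: ready_frame rs => // r /hd hr; rewrite /= update_ne.
apply: (for_ready (I := fun m s' => reg s' dst = \sum_(j < m) (arr s aP j == reg s src))) => //.
- apply/andP; split=> //; apply/allP => r hr; rewrite /= !inE negb_or (hd _ hr) andbT.
  by move: hr; rewrite !inE => /or3P[||/or4P[]] /eqP ->.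
- by case: rs0 => -[].
- by rewrite big_ord0 /s0 /= update_eq.
move=> j s' hj fr fa rs' h; rewrite eval_if_eq big_ord_recr /= -h.
have -> : arr s' aP = arr s aP by rewrite fa.
have -> : update (reg s') rindex j src = reg s src.
  rewrite update_ne // fr /s0 /= ?update_ne // 1?eq_sym //.
  by rewrite /= !inE negb_or nsj eq_sym.
by rewrite update_eq; case: eqP => _ /=; rewrite ?update_eq update_ne ?addn0.
Qed.

Definition tokens (p c : nat -> nat) (j : nat) : nat := p j * l + c j.

Definition state_number (p c : nat -> nat) : nat := encode k B (tokens p c).

Definition bounded (p c : nat -> nat) : Prop :=
  forall j, j < k -> p j < n /\ c j < l.

Lemma tokens_lt p c : bounded p c -> forall j, j < k -> tokens p c j < B.
Proof.
move=> h j hj; have [h1 h2] := h j hj; rewrite /tokens /B.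
apply: (@leq_trans ((p j).+1 * l)); last by rewrite leq_mul2r h1 orbT.
by rewrite mulSn addnC ltn_add2r.
Qed.

(** The digit gains at least [l] from the position and loses at most 1 from the counter. If it does
    lose 1, then [0 < c i < l] gives [1 < l], so the net change is positive. *)
Lemma state_number_move p c i w : i < k -> p i < w -> c i < l ->
  let s' := state_number (update p i w) (update c i (c i).-1) in
  s' = state_number p c - (if 0 < c i then B ^ i else 0) + (w - p i) * (l * B ^ i) /\
  state_number p c < s'.
Proof.
move=> hi pw cl; cbv zeta; rewrite /state_number.
have -> : encode k B (tokens (update p i w) (update c i (c i).-1)) =
          encode k B (update (tokens p c) i (w * l + (c i).-1)).
  apply: eq_bigr => j _; rewrite /tokens /update.
  by case: (eqVneq (nat_of_ord j) i) => [->|].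
have := encode_update B (tokens p c) (w * l + (c i).-1) hi.
set E := encode _ _ (update _ _ _); set S := encode _ _ (tokens p c).
have hS : tokens p c i * B ^ i <= S.
  by rewrite /S /encode (bigD1 (Ordinal hi)) //= leq_addr.
move: hS; have : 0 < B ^ i by rewrite expn_gt0 /B muln_gt0 n_gt0 l_gt0.
move: (B ^ i) => X X0; rewrite /tokens -(subnKC pw); move: (w - (p i).+1) => e.
rewrite addSn -addnS addKn !mulnDl -!mulnA; move: (p i * (l * X)) => Z.
rewrite mulSn; move: (e * (l * X)) => Y.
have [->|c0] := posnP (c i); first by rewrite /= mul0n; have : 0 < l * X; [by rewrite muln_gt0 l_gt0|lia].
case: (c i) c0 cl => // c' _ cl; rewrite mulSn /=.
have : X < l * X by rewrite -[X in X < _]mul1n ltn_pmul2r //; lia.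
lia.
Qed.

Lemma try_movesP s : ready s ->
  let p := arr s aP in let c := arr s aC in let i := reg s rtoken in
  i < k -> reg s rbest = p i -> bounded p c -> reg s rstate = state_number p c ->
  reg (eval inp try_moves s) rwin != 0 <->
  exists w, movable n A (reg s rtarget) k p c i w /\
    arr s aT (state_number (update p i w) (update c i (c i).-1)) != 0.
Proof.
move=> ok; set p := arr s aP; set c := arr s aC; set i := reg s rtoken; set v := reg s rtarget.
cbv zeta => hi hbest hb hs.
have [pin cil] := hb i hi.
rewrite /try_moves 2!eval_seq eval_assign.
set s1 := eval inp (count_at rcount rbest) _.
have rs1 : ready s1 by apply: ready_eval.
have cnt1 : reg s1 rcount = \sum_(j < k) (p j == p i).
  by rewrite /s1 count_atP // -hbest.
have fr1 r : r \notin [:: rwin; rcount; rindex] -> reg s1 r = reg s r.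
  rewrite !inE !negb_or => /and3P[h1 h2 h3].
  by rewrite /s1 frame_reg /= ?update_ne // !inE !negb_or h2 h3.
have val1 : reg s1 rwin = 0 by rewrite /s1 frame_reg.
have fa1 a : arr s1 a = arr s a by rewrite /s1 frame_arr.
rewrite 3!eval_seq 2!eval_assign.
set s2 := eval inp (If _ _ _ _) _.
pose d := if 0 < c i then B ^ i else 0.
have [_ _ hW _] := ok; have [Wi LWi] := hW i hi.
have c1 : arr s1 aC (reg s1 rtoken) = c i by rewrite fa1 fr1.
have e2 : [/\ reg s2 rcount = reg s1 rcount, reg s2 rcounter = c i, reg s2 rnext = reg s rstate - d,
              reg s2 rwin = 0 & forall a, arr s2 a = arr s a].
  have s2E : s2 = if 0 < c i then set_reg (set_reg (set_reg s1 rcounter (c i)) rnext (reg s rstate)) rnext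
      (reg s rstate - B ^ i) else set_reg (set_reg s1 rcounter (c i)) rnext (reg s rstate).
    by rewrite /s2 /= /update /= c1 !fr1 // fa1 Wi.
  rewrite s2E /d; case: ifP => _; rewrite /= /update /=; split=> //; lia.
case: e2 => cnt2 rc2 q2 val2 fa2.
have fr2 r : r \notin [:: rwin; rcount; rindex; rcounter; rnext] -> reg s2 r = reg s r.
  rewrite !inE !negb_or => /and5P[h1 h2 h3 h4 h5].
  rewrite /s2 frame_reg; last by rewrite !inE.
  by rewrite /= /update (negbTE h4) (negbTE h5) fr1 // !inE !negb_or h1 h2 h3.
have rs2 : ready s2.
  apply: (ready_frame _ _ ok) => [r|a _]; last exact: fa2.
  by rewrite !inE => /or3P[||/or4P[]] /eqP ->; rewrite fr2.
pose T := arr s aT.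
pose num w := state_number (update p i w) (update c i (c i).-1).
have loop : reg s2 rn = n by case: rs2 => -[].
have := for_ready (I := fun m s' => reg s' rnext = reg s rstate - d + (m.-1 - p i) * (l * B ^ i) /\
  (reg s' rwin != 0 <-> exists2 w, w < m & movable n A v k p c i w /\ T (num w) != 0))
  (x := rvertex) (c := try_move) isT rs2 loop.
move=> h; have [||_ ->] := h.
- rewrite q2 mul0n addn0 val2 eqxx; split=> //; split=> // -[] //.
- move=> j s' hj fr fa rs' [hq hval].
  have s'E r : r \notin [:: rwin; rcount; rindex; rcounter; rnext; rvertex; rblock; rneed] -> reg s' r = reg s r.
    move=> hr; rewrite fr ?fr2 //.
      by apply: contra hr; rewrite !inE; do 4?[case/orP=> [->|]; rewrite ?orbT //]; move=> ->; rewrite ?orbT.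
    by apply: contra hr => /=; rewrite !inE => h'; move: h'; lia.
  have rc' : reg s' rcounter = c i by rewrite fr.
  have cnt' : reg s' rcount = \sum_(j < k) (p j == p i) by rewrite fr // cnt2.
  have s'A a : arr s' a = arr s a by rewrite fa // fa2.
  have split_w (P : nat -> Prop) :
      (exists2 w, w < j.+1 & P w) <-> (exists2 w, w < j & P w) \/ P j.
    split=> [[w]|[[w wj Pw]|Pj]]; last by exists j.
      by rewrite ltnS leq_eqVlt => /orP[/eqP ->|wj] Pw; [right|left; exists w].
    by exists w => //; apply: ltnW.
  rewrite split_w -hval /try_move.
  set sx := set_reg s' rvertex j.
  have best_x : reg sx rbest = p i by rewrite /sx /= /update /= s'E.
  have x_x : expr_eval inp sx (Var rvertex) = j by [].
  rewrite eval_if [expr_eval _ _ _]best_x x_x.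
  case: ltnP => hpj; last first.
    have -> : movable n A v k p c i j = false by rewrite /movable ltnNge hpj.
    rewrite /= /update /= hq; split; first by rewrite (_ : j.-1 - p i = j - p i) //; lia.
    by split=> [|[|[]//]] //; left.
  rewrite eval_seq eval_assign eval_seq; set t1 := set_reg sx rnext _.
  have ok1 : ready t1 by exact: rs'.
  set t2 := eval inp (count_at rblock rvertex) t1.
  have rm2 : reg t2 rblock = \sum_(w < k) (p w == j) by rewrite /t2 count_atP //= s'A.
  have frt2 r : r \notin [:: rblock; rindex] -> reg t2 r = reg t1 r.
    by rewrite !inE negb_or => /andP[g1 g2]; rewrite frame_reg // !inE !negb_or g1 g2.
  have fat2 a : arr t2 a = arr s a by rewrite frame_arr // -s'A.
  have numE := state_number_move hi hpj cil.
  have q2' : reg t2 rnext = num j.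
    rewrite frt2 // /t1 /= /update /= s'A (s'E rtoken) // LWi hq /num (proj1 numE) -hs -/d.
    have : j - p i = (j.-1 - p i).+1 by lia.
    by move=> ->; rewrite mulSn; lia.
  rewrite eval_seq eval_assign eval_seq eval_if_eq.
  set t3 := set_reg t2 rneed _.
  have [x3 v3] : reg t3 rvertex = j /\ reg t3 rtarget = v.
    by rewrite /t3 /= /update /= !frt2 // /t1 /= /update /= s'E.
  rewrite [expr_eval _ t3 (Var rvertex)]x3 [expr_eval _ t3 (Var rtarget)]v3.
  set t4 := if _ then _ else _.
  have e4 : [/\ reg t4 rblock = (if j == v then c i else \sum_(w < k) (p w == j)),
      reg t4 rneed = (if j == v then \sum_(w < k) (p w == p i) else 1),
      forall r, r \notin [:: rblock; rneed] -> reg t4 r = reg t2 r &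
      forall a, arr t4 a = arr s a].
    have rct2 : reg t2 rcounter = c i by rewrite frt2 // -rc'.
    have cntt2 : reg t2 rcount = \sum_(w < k) (p w == p i) by rewrite frt2 // -cnt'.
    rewrite /t4; case: eqP => _; rewrite /= /update /= ?rct2 ?cntt2 ?rm2; split=> //.
    - by move=> r; rewrite !inE negb_or => /andP[/negbTE -> /negbTE ->].
    - by move=> r; rewrite !inE negb_or => /andP[_ /negbTE ->].
  case: e4 => m4 thr4 fr4 fa4.
  have jn : j < n by [].
  have arc4 : expr_eval inp t4 (arc_entry rbest rvertex) = A (p i) j.
    have [_ hA _ _] := ok.
    by rewrite /= !fa4 !fr4 // !frt2 // -hA // -best_x.
  have test4 : (reg t4 rblock < 1) && (reg t4 rneed < A (p i) j + 1) = movable n A v k p c i j.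
    rewrite m4 thr4 /movable hpj jn /= addn1 !ltnS leqn0.
    by case: (j == v); rewrite ?leqn0.
  have q4 : reg t4 rnext = num j by rewrite fr4.
  have val4 : reg t4 rwin = reg s' rwin by rewrite fr4 // frt2.
  have -> : eval inp (If (Var rblock) (Num 1)
      (If (Var rneed) (Plus (arc_entry rbest rvertex) (Num 1))
        (If (Num 0) (Cell aT (Var rnext)) (Assign rwin (Num 1)) Skip) Skip) Skip) t4 =
    if movable n A v k p c i j && (T (num j) != 0) then set_reg t4 rwin 1 else t4.
    rewrite 3!eval_if -test4.
    have -> : expr_eval inp t4 (Plus (arc_entry rbest rvertex) (Num 1)) = A (p i) j + 1.
      by rewrite -arc4.
    have -> : expr_eval inp t4 (Cell aT (Var rnext)) = T (num j) by rewrite /= fa4 q4.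
    rewrite -lt0n [expr_eval _ _ (Var rblock)]/= [expr_eval _ _ (Var rneed)]/= [expr_eval _ _ (Num _)]/=.
    by case: (_ < 1); case: (_ < _ + 1).
  rewrite (_ : reg (if _ then _ else _) rnext = num j); last by case: ifP.
  split; first by rewrite /num (proj1 numE) -hs.
  case: (movable n A v k p c i j) => /=; last by rewrite val4; split=> [|[|[]//]] //; left.
  case: (eqVneq (T (num j)) 0) => hT /=; last by split=> // _; right.
  by rewrite val4; split=> [|[|[]//]] //; left.
by split=> [[w _ hw]|[w hw]]; exists w => //; case: hw => /andP[/andP[_]].
Qed.

Lemma decrementP s : ready s ->
  let p := arr s aP in let c := arr s aC in bounded p c ->
  let s' := eval inp decrement s in
  bounded (arr s' aP) (arr s' aC) /\
  (0 < state_number p c -> state_number (arr s' aP) (arr s' aC) + 1 = state_number p c).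
Proof.
move=> ok; set p := arr s aP; set c := arr s aC; cbv zeta => hb.
rewrite /decrement eval_seq eval_assign; set s0 := set_reg _ _ _.
have ok0 : ready s0 by exact: ok.
have k0 : reg s0 rk = k by case: ok0 => -[].
have := for_ready (I := fun m s' =>
  let p' := arr s' aP in let c' := arr s' aC in
  [/\ bounded p' c', reg s' rborrow <= 1, forall j, m <= j -> p' j = p j /\ c' j = c j &
   \sum_(j < m) tokens p' c' j * B ^ j + 1 =
   \sum_(j < m) tokens p c j * B ^ j + reg s' rborrow * B ^ m]) (x := rindex) (c := decrement_body) isT ok0 k0.
case.
- by split; rewrite ?big_ord0 //; exact: hb.
- move=> j s' hj fr fa ok' [hb' b1 hge hsum].
  have [p'j c'j] := hge j (leqnn _).
  have [[n' _ l'] _ _ _] := ok'.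
  set sj := set_reg s' rindex j.
  have [pj cj] := hb j hj.
  pose u := reg s' rborrow.
  (* All branches reduce to one digit equation: new digit plus incoming borrow equals old digit plus
     [B] times the outgoing borrow. *)
  have key pj' cj' b' s2 :
      arr s2 aP =1 update (arr s' aP) j pj' -> arr s2 aC =1 update (arr s' aC) j cj' ->
      reg s2 rborrow = b' -> pj' < n -> cj' < l -> b' <= 1 ->
      pj' * l + cj' + u = p j * l + c j + b' * B ->
      [/\ bounded (arr s2 aP) (arr s2 aC), reg s2 rborrow <= 1,
        forall i, j.+1 <= i -> arr s2 aP i = p i /\ arr s2 aC i = c i &
        \sum_(i < j.+1) tokens (arr s2 aP) (arr s2 aC) i * B ^ i + 1 =
        \sum_(i < j.+1) tokens p c i * B ^ i + reg s2 rborrow * B ^ j.+1].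
    move=> eP eC -> hp hc hb1 e; split=> //.
    + by move=> i hi; rewrite eP eC /update; case: eqP => // _; apply: hb'.
    + move=> i hi; rewrite eP eC /update gtn_eqF //; apply: hge; exact: ltnW.
    rewrite !big_ord_recr /=.
    rewrite (eq_bigr (fun i : 'I_j => tokens (arr s' aP) (arr s' aC) i * B ^ i)); last first.
      by move=> i _; rewrite /tokens eP eC /update !ltn_eqF.
    rewrite {2}/tokens eP eC !update_eq expnS mulnA.
    have := congr1 (muln^~ (B ^ j)) e; rewrite mulnDl [RHS]mulnDl.
    rewrite -[p j * l + c j]/(tokens p c j); move: hsum; rewrite -/u.
    move: (\sum_(i < j) _) (\sum_(i < j) _) => S S'; lia.
  have keep g x : g j = x -> g =1 update g j x.
    by move=> <- i; rewrite /update; case: eqP => // ->.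
  have P1 : expr_eval inp sj (Cell aP (Var rindex)) = p j by rewrite -p'j.
  have C1 : expr_eval inp sj (Cell aC (Var rindex)) = c j by rewrite -c'j.
  rewrite /decrement_body 2!eval_if C1 [expr_eval _ sj (Var rborrow)]/= [update _ _ _ _]/= [expr_eval _ _ (Num _)]/=.
  change (update (reg s') rindex j rborrow) with u.
  case: (posnP u) => [u0|u_gt0].
    apply: (key (p j) (c j) 0) => //; first exact: keep p'j.
      exact: keep c'j.
    by rewrite u0 mul0n.
  have u1 : u = 1 by move: b1 u_gt0; rewrite -/u; lia.
  rewrite u1 in key.
  case: posnP => cj0.
    rewrite eval_seq eval_if.
    set s2 := eval inp (Store _ _ _) sj.
    have P2 : expr_eval inp s2 (Cell aP (Var rindex)) = p j by rewrite -p'j.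
    have C2 : arr s2 aC = update (arr s' aC) j l.-1.
      by rewrite /s2 /= /update /= l' subn1.
    rewrite P2 [expr_eval _ _ (Num _)]/=; case: posnP => pj0.
      apply: (key n.-1 l.-1 1); rewrite ?pj0 ?cj0 /=.
      - by rewrite /update /= n' subn1.
      - by rewrite -C2.
      - by rewrite /update /= -/u u1.
      - by rewrite prednK.
      - by rewrite prednK.
      - by [].
      - rewrite /B mul1n -{2}(prednK n_gt0) mulSn; lia.
    apply: (key (p j).-1 l.-1 0); rewrite ?cj0 /=.
    - by rewrite /update /= p'j subn1.
    - by rewrite -C2.
    - by [].
    - by apply: leq_ltn_trans pj; apply: leq_pred.
    - by rewrite prednK.
    - by [].
    - rewrite -{2}(prednK pj0) mulSn; lia.
  apply: (key (p j) (c j).-1 0); rewrite /=.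
  - exact: keep p'j.
  - by rewrite /update /= c'j subn1.
  - by [].
  - by [].
  - by apply: leq_ltn_trans cj; apply: leq_pred.
  - by [].
  - lia.
move=> hb' b1 _ hsum; split=> // pos; rewrite /state_number /encode hsum.
(* A borrow out of the last digit would make the new number plus 1 equal to the old number plus
   [B ^ k]; as the new number is below [B ^ k], the old one would be 0. *)
have lt1 := digits_lt (tokens_lt hb').
move: pos b1 hsum; rewrite /state_number /encode.
case: (reg _ rborrow) => [|[|//]]; first by rewrite mul0n addn0.
rewrite mul1n; move: lt1; lia.
Qed.
Hypothesis A_lt : forall x y, 0 < A x y -> x < y < n.

(** Entries below [m] are unconstrained and may be left over from an earlier target: moves lead only
    to larger numbers, so such entries are overwritten before they are read. *)
Definition table_correct (T : nat -> nat) (v m : nat) : Prop :=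
  forall p c, bounded p c -> m <= state_number p c ->
    T (state_number p c) != 0 <-> routable A v k p c.

Lemma state_number_inj p c p' c' : bounded p c -> bounded p' c' ->
  state_number p c = state_number p' c' -> forall j, j < k -> p j = p' j /\ c j = c' j.
Proof.
move=> hb hb' e j hj.
have := encode_inj (tokens_lt hb) (tokens_lt hb') e hj; rewrite /tokens => {}e.
have [_ cj] := hb j hj; have [_ c'j] := hb' j hj.
have := congr1 (divn^~ l) e; have := congr1 (modn^~ l) e.
by rewrite /= !modnMDl !divnMDl // !modn_small // !divn_small // !addn0.
Qed.

Lemma process_stateP s : ready s ->
  bounded (arr s aP) (arr s aC) -> state_number (arr s aP) (arr s aC) + 1 = reg s rstate ->
  table_correct (arr s aT) (reg s rtarget) (reg s rstate) ->
  let s' := eval inp process_state s in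
  [/\ reg s' rstate + 1 = reg s rstate, bounded (arr s' aP) (arr s' aC),
    0 < reg s' rstate -> state_number (arr s' aP) (arr s' aC) + 1 = reg s' rstate &
    table_correct (arr s' aT) (reg s rtarget) (reg s' rstate)].
Proof.
move=> ok hb hs tab; cbv zeta.
set p := arr s aP in hb hs *; set c := arr s aC in hb hs *.
rewrite /process_state eval_seq eval_assign eval_seq.
set s1 := set_reg _ _ _; have ok1 : ready s1 by exact: ok.
have rs1 : reg s1 rstate = state_number p c by rewrite /s1 /= update_eq -hs addnK.
set s2 := eval inp scan s1; have ok2 : ready s2 by apply: ready_eval.
have scan2 := scanP ok1 (fun j hj => (hb j hj).1); rewrite -/s2 /= in scan2.
have fa2 a : arr s2 a = arr s a by rewrite frame_arr.
have rs2 : reg s2 rstate = state_number p c by rewrite frame_reg.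
have rv2 : reg s2 rtarget = reg s rtarget by rewrite frame_reg.
rewrite eval_seq; set s3 := eval inp (If _ _ _ _) s2.
have ok3 : ready s3 by apply: ready_eval.
have fa3 a : arr s3 a = arr s a by rewrite frame_arr.
have rs3 : reg s3 rstate = state_number p c by rewrite frame_reg.
have val3 : reg s3 rwin != 0 <-> routable A (reg s rtarget) k p c.
  have n2 : reg s2 rn = n by case: ok2 => -[].
  rewrite /s3 eval_if [expr_eval _ _ (Var rbest)]/= [expr_eval _ _ (Var rn)]/= n2.
  case: scan2 => [[-> pv]|[hi piv hbest pmin pfirst]].
    by rewrite ltnn; split=> // _; apply: routable_end.
  rewrite hbest (hb _ hi).1 (routable_move A_lt c hi piv pmin pfirst).
  have := try_movesP ok2; rewrite !fa2 => /(_ hi hbest hb rs2) ->.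
  rewrite rv2; split=> -[w [mv hw]]; exists w; split=> //;
    have /andP[/andP[pw wn] _] := mv;
    have [_ lt] := state_number_move hi pw (hb _ hi).2;
    (have hb' : bounded (update p (reg s2 rtoken) w) (update c (reg s2 rtoken) (c (reg s2 rtoken)).-1)
      by move=> j hj; rewrite /update; case: eqP => _; have [h1 h2] := hb j hj;
         rewrite ?h1 ?h2 ?wn //; split=> //; have [_ h3] := hb _ hi; lia);
    have := tab _ _ hb'; rewrite -hs addn1 => /(_ lt) h; exact/h.
rewrite eval_seq; set s4 := eval inp (Store _ _ _) s3.
have ok4 : ready s4 by exact: ok3.
have e4 : [/\ arr s4 aP = p, arr s4 aC = c & reg s4 rstate = state_number p c].
  by rewrite /s4 /= !fa3.
case: e4 => p4 c4 rs4.
have hb4 : bounded (arr s4 aP) (arr s4 aC) by rewrite p4 c4.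
have [hb5 dec5] := decrementP ok4 hb4; set s5 := eval inp decrement s4 in hb5 dec5 *.
have rs5 : reg s5 rstate = state_number p c by rewrite frame_reg.
rewrite rs5; split=> //; first by move=> pos; rewrite dec5 p4 c4.
have -> : arr s5 aT = update (arr s aT) (state_number p c) (reg s3 rwin).
  by rewrite frame_arr // /s4 /= fa3 rs3.
move=> p' c' hb' le; rewrite /update.
case: (eqVneq (state_number p' c') (state_number p c)) => e; last first.
  by apply: tab => //; rewrite -hs; lia.
rewrite val3; have pc := state_number_inj hb' hb e.
by split; apply: routable_ext => j hj; have [e1 e2] := pc j hj.
Qed.

Lemma queryP s : ready s ->
  reg (eval inp query s) racc != 0 <->
  reg s racc != 0 \/ exists u, [/\ u < n, u < reg s rtarget &
    arr s aT (state_number (fun=> u) (fun=> l.-1)) != 0].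
Proof.
move=> ok; rewrite /query eval_seq eval_assign; set s0 := set_reg _ _ _.
have [[n0 _ _] _ _ [sw sl _]] := ok.
set body := Seq _ _; pose SL := \sum_(j < k) l * B ^ j; pose SW := \sum_(j < k) B ^ j.
have num u : state_number (fun=> u) (fun=> l.-1) = SL - SW + u * SL.
  rewrite /state_number /encode /tokens.
  have SLE : SL = \sum_(j < k) l.-1 * B ^ j + SW.
    by rewrite -big_split; apply: eq_bigr => j _ /=; rewrite -{1}(prednK l_gt0) mulSn addnC.
  rewrite {1}SLE addnK /SL big_distrr -big_split.
  by apply: eq_bigr => j _ /=; rewrite mulnDl mulnA addnC.
have ok0 : ready s0 by exact: ok.
have nn : reg s0 rn = n by [].
have := for_ready (I := fun m s' => reg s' rnext = SL - SW + m * SL /\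
   (reg s' racc != 0 <-> reg s racc != 0 \/ exists u, [/\ u < m, u < reg s rtarget &
    arr s aT (state_number (fun=> u) (fun=> l.-1)) != 0])) (x := rstart) (c := body) isT ok0 nn.
case=> //.
- rewrite mul0n addn0 /s0 /= /update /= sl sw; split=> //.
  by split=> [|[//|[u []]//]]; left.
move=> j s' hj fr fa ok' [hq hacc].
have sl' : reg s' rlsum = SL by case: ok' => _ _ _ [].
have rv' : reg s' rtarget = reg s rtarget by rewrite fr.
have T' : arr s' aT = arr s aT by rewrite fa.
rewrite /body eval_seq eval_assign; set s2 := eval _ _ _.
have s2E : s2 = if (j < reg s rtarget) && (arr s aT (SL - SW + j * SL) != 0)
    then set_reg (set_reg s' rstart j) racc 1 else set_reg s' rstart j.
  rewrite /s2 2!eval_if /= /update /= rv' T' hq -lt0n.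
  by case: (j < _); case: (0 < _).
split.
  by rewrite s2E; case: ifP => _; rewrite /= /update /= hq sl' mulSn; lia.
have -> : reg (set_reg s2 rnext (expr_eval inp s2 (Plus (Var rnext) (Var rlsum)))) racc = reg s2 racc by [].
have split_u (P : nat -> Prop) : (exists u, [/\ u < j.+1, u < reg s rtarget & P u]) <->
   (exists u, [/\ u < j, u < reg s rtarget & P u]) \/ (j < reg s rtarget /\ P j).
  split=> [[u []]|[[u [h1 h2 h3]]|[h1 h2]]]; last by exists j.
    by rewrite ltnS leq_eqVlt => /orP[/eqP -> *|h1 h2 h3]; [right|left; exists u].
  by exists u; split=> //; apply: ltnW.
rewrite split_u (num j) s2E.
case: ifP => [/andP[h1 h2]|h]; rewrite [reg _ _]/=.
  by rewrite /update /=; split=> // _; right; right.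
rewrite [update _ _ _ _]/= hacc; split=> [[h1|h1]|[h1|[h1|[h1 h2]]]]; auto.
by move: h; rewrite h1 h2.
Qed.

Lemma solve_targetP s : ready s ->
  reg (eval inp solve_target s) racc != 0 <->
  reg s racc != 0 \/ exists u, [/\ u < n, u < reg s rtarget &
    routable A (reg s rtarget) k (fun=> u) (fun=> l.-1)].
Proof.
move=> ok; rewrite /solve_target eval_seq.
set s1 := eval inp init_tokens s; have ok1 : ready s1 by apply: ready_eval.
have tok1 := init_tokensP ok; rewrite -/s1 in tok1.
rewrite eval_seq eval_assign; set s2 := set_reg _ _ _.
have ok2 : ready s2 by exact: ok1.
have N1 : reg s1 rtotal = B ^ k by case: ok1 => _ _ _ [].
have N2 : reg s2 rtotal = B ^ k by exact: N1.
have v2 : reg s2 rtarget = reg s rtarget by rewrite /s2 /= update_ne // frame_reg.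
have hb2 : bounded (arr s2 aP) (arr s2 aC).
  by move=> j hj; have [-> ->] := tok1 j hj; rewrite !prednK.
(* All digits start at [B - 1]. *)
have num2 : state_number (arr s2 aP) (arr s2 aC) + 1 = B ^ k.
  rewrite /state_number /encode -[RHS](muln1 (B ^ k)).
  have : forall m, m <= k ->
      \sum_(j < m) tokens (arr s2 aP) (arr s2 aC) j * B ^ j + 1 = B ^ m.
    elim=> [|m IH] hm; first by rewrite big_ord0.
    rewrite big_ord_recr /= addnAC IH ?(ltnW hm) // expnS.
    rewrite /tokens; have [-> ->] := tok1 m hm.
    have -> : B = (n.-1 * l + l.-1).+1.
      by rewrite /B -{1}(prednK n_gt0) mulSn -{1}(prednK l_gt0); lia.
    by rewrite mulSn.
  by move=> /(_ k (leqnn k)) ->; rewrite muln1.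
rewrite eval_seq; set s3 := eval inp (For _ _ _) s2.
have ok3 : ready s3 by apply: ready_eval.
have v3 : reg s3 rtarget = reg s rtarget by rewrite frame_reg.
have acc3 : reg s3 racc = reg s racc.
  by rewrite frame_reg // /s2 /= update_ne // frame_reg.
have := for_ready (I := fun m s' =>
  [/\ reg s' rstate + m = B ^ k, bounded (arr s' aP) (arr s' aC),
    0 < reg s' rstate -> state_number (arr s' aP) (arr s' aC) + 1 = reg s' rstate &
    table_correct (arr s' aT) (reg s rtarget) (reg s' rstate)]) (x := rstep) (c := process_state)
  isT ok2 N2.
rewrite -/s3; case.
- have rs2 : reg s2 rstate = B ^ k by rewrite /s2 /= update_eq.
  (* No state has number [B ^ k] or more, so any initial contents of the table are correct. *)
  rewrite rs2 addn0; split=> // p c hb; rewrite leqNgt.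
  by rewrite [_ < _](digits_lt (tokens_lt hb)).
- move=> j s' hj fr fa ok' [h1 h2 h3 h4].
  set s4 := set_reg s' rstep j; have ok4 : ready s4 by exact: ok'.
  have v4 : reg s4 rtarget = reg s rtarget by rewrite -v2 -fr.
  have pos : 0 < reg s' rstate by lia.
  have h4' : table_correct (arr s4 aT) (reg s4 rtarget) (reg s4 rstate) by rewrite v4.
  have := process_stateP ok4 h2 (h3 pos) h4'.
  cbv zeta; rewrite v4; case=> g1 g2 g3 g4; split=> //.
  by rewrite -h1 -[reg s' rstate]/(reg s4 rstate) -g1 addnAC -addnA addn1.
move=> h1 _ _ tab.
rewrite queryP // acc3 v3.
have rs0 : reg s3 rstate = 0 by lia.
have iff u : u < n -> (arr s3 aT (state_number (fun=> u) (fun=> l.-1)) != 0) <->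
    routable A (reg s rtarget) k (fun=> u) (fun=> l.-1).
  by move=> un; apply: tab => [j _|]; rewrite ?rs0 ?prednK.
by split=> [[h|[u [un uv /(iff _ un) hu]]]|[h|[u [un uv /(iff _ un) hu]]]];
  [left | right; exists u | left | right; exists u].
Qed.

Lemma solveP s : ready s -> reg s racc = 0 ->
  reg (eval inp solve s) racc != 0 <->
  exists u v, u < v < n /\ routable A v k (fun=> u) (fun=> l.-1).
Proof.
move=> ok acc0; rewrite /solve.
have nn : reg s rn = n by case: ok => -[].
have := for_ready (I := fun m s' => reg s' racc != 0 <-> exists u v, v < m /\
  (u < v < n /\ routable A v k (fun=> u) (fun=> l.-1))) (x := rtarget) (c := solve_target) isT ok nn.
move=> h; rewrite h; first by split=> [[u [v [_ ?]]]|[u [v hv]]]; exists u, v => //; case: (hv) => /andP[].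
  by rewrite acc0; split=> // -[u [v []]].
move=> j s' hj fr fa ok' IH; rewrite solve_targetP //.
have -> : reg (set_reg s' rtarget j) racc = reg s' racc by [].
have -> : reg (set_reg s' rtarget j) rtarget = j by [].
rewrite IH; split=> [[[u [v [h1 h2]]]|[u [un uj hu]]]|[u [v [h1 [h2 h3]]]]].
- by exists u, v; split=> //; apply: ltnW.
- by exists u, j; split=> //; rewrite uj.
move: h1; rewrite ltnS leq_eqVlt => /orP[/eqP ej|vj]; last by left; exists u, v.
by right; exists u; rewrite -ej; case/andP: h2 => uv vn; split=> //; apply: ltn_trans vn.
Qed.

End Search.

(** * Running time *)

Fixpoint bounds (c : cmd) : seq nat :=
  match c with
  | Skip | Assign _ _ | Store _ _ _ => [::]
  | Seq c1 c2 | If _ _ c1 c2 => bounds c1 ++ bounds c2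
  | For _ b c => b :: bounds c
  end.

(** Unlike [time], this does not depend on the run: both branches are charged, and loop bounds are
    read off a fixed valuation [g]. *)
Fixpoint cost (g : nat -> nat) (c : cmd) : nat :=
  match c with
  | Skip => 0
  | Assign x e => expr_size e + 1
  | Store a e1 e2 => expr_size e1 + 6 + expr_size e2 + 1
  | Seq c1 c2 => cost g c1 + cost g c2
  | If e1 e2 c1 c2 => expr_size e1 + expr_size e2 + 1 + (cost g c1 + cost g c2 + 1)
  | For x b c => 4 + g b * (3 + cost g c)
  end.

(** If no register bounding a loop of [c] is written in [c], then [g] stays valid throughout; this
    syntactic condition is checked by computation. *)
Lemma time_cost inp g c s :
  all (fun b => b \notin assigned c) (bounds c) ->
  (forall b, b \in bounds c -> reg s b = g b) ->
  time inp c s <= cost g c.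
Proof.
have sub (c1 c2 : cmd) (l : seq nat) : all (fun b => b \notin assigned c1 ++ assigned c2) l ->
    all (fun b => b \notin assigned c1) l && all (fun b => b \notin assigned c2) l.
  by rewrite -all_predI; apply: sub_all => b; rewrite mem_cat negb_or.
elim: c s => [|x e|a e1 e2|c1 IH1 c2 IH2|e1 e2 c1 IH1 c2 IH2|x b c IH] s //=.
- rewrite all_cat => /andP[/sub/andP[h11 h12] /sub/andP[h21 h22]] hg.
  apply: leq_add; first by apply: IH1 => // b hb; apply: hg; rewrite mem_cat hb.
  apply: IH2 => // b hb; rewrite frame_reg; last exact: (allP h21).
  by apply: hg; rewrite mem_cat hb orbT.
- rewrite all_cat => /andP[/sub/andP[h11 h12] /sub/andP[h21 h22]] hg.
  have t1 : time inp c1 s <= cost g c1.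
    by apply: IH1 => // b hb; apply: hg; rewrite mem_cat hb.
  have t2 : time inp c2 s <= cost g c2.
    by apply: IH2 => // b hb; apply: hg; rewrite mem_cat hb orbT.
  by case: ifP => _; lia.
move=> /andP[hb hall] hg.
have hgb : reg s b = g b by apply: hg; rewrite mem_head.
rewrite leq_add2l -hgb -[X in X * _]card_ord -sum_nat_const.
apply: leq_sum => i _; rewrite leq_add2l; apply: IH.
  by apply: sub_all hall => b'; rewrite inE negb_or => /andP[].
move=> b' hb'; have := allP hall b' hb'; rewrite inE negb_or => /andP[b'x b'c].
rewrite /= update_ne // -(hg b'); last by rewrite inE hb' orbT.
apply: (@iteri_ind _ (fun _ s' => reg s' b' = reg s b')) => // j s' _ <-.
by rewrite frame_reg //= update_ne.
Qed.

Lemma time_seq inp c1 c2 s :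
  time inp (Seq c1 c2) s = time inp c1 s + time inp c2 (eval inp c1 s).
Proof. by []. Qed.

Lemma time_assign inp x e s : time inp (Assign x e) s = expr_size e + 1.
Proof. by []. Qed.

Lemma time_if inp e1 e2 c1 c2 s :
  time inp (If e1 e2 c1 c2) s = expr_size e1 + expr_size e2 + 1 +
    if expr_eval inp s e1 < expr_eval inp s e2 then time inp c1 s else time inp c2 s + 1.
Proof. by []. Qed.

(** * The whole program and its cost *)

Definition body : cmd := Seq sort_vertices (Seq weights solve).

(** A spindle has two end-vertices, so for [n < 2] the answer is the initial 0 of [racc]. The answer
    is moved to register 0, where [accepting] looks for it. *)
Definition main : cmd := Seq (If (Var rn) (Num 2) Skip body) (Assign rn (Var racc)).

Lemma nth_allpairs (S T : Type) (R : Type) (F : S -> T -> R) (z : R) x0 y0 s t i j :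
  i < size s -> j < size t ->
  nth z [seq F x y | x <- s, y <- t] (i * size t + j) = F (nth x0 s i) (nth y0 t j).
Proof.
elim: s i => // x s IH [|i] /= hi hj; rewrite nth_cat size_map.
  by rewrite mul0n add0n hj (nth_map y0).
by rewrite mulSn -addnA ltnNge leq_addr /= addKn IH.
Qed.


Section Main.
Variables (n k l : nat) (G : digraph) (f : 'I_n -> vertices G).
Hypotheses (f_bij : bijective f) (acyc : acyclic G) (k_gt0 : 0 < k) (l_gt0 : 0 < l).

Let inp := nth 0 (adjacency_matrix f).
Let s0 := initial_store [:: n; k; l].

Lemma size_adjacency_matrix : size (adjacency_matrix f) = n * n.
Proof. by rewrite size_allpairs !size_enum_ord. Qed.

Lemma nth_adjacency_matrix (i j : 'I_n) : inp (i * n + j) = multiplicity (f i) (f j).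
Proof.
have := @nth_allpairs _ _ _ (fun i j => multiplicity (f i) (f j)) 0 i j (enum 'I_n) (enum 'I_n) i j.
by rewrite !size_enum_ord !nth_ord_enum; apply.
Qed.

Lemma input_source (U : pred nat) : (exists2 x, x < n & U x) ->
  exists2 x, x < n & U x /\ forall y, y < n -> U y -> inp (y * n + x) = 0.
Proof.
move=> [x0 x0n Ux0]; have [f' fK Kf] := f_bij.
have U0 : f (Ordinal x0n) \in [set z | U (f' z)] by rewrite inE fK.
have [z] := acyclic_source acyc U0; rewrite inE => Uz hz.
exists (f' z) => //; split=> // y yn Uy.
rewrite -[y]/(nat_of_ord (Ordinal yn)) nth_adjacency_matrix Kf.
by apply: hz; rewrite inE fK.
Qed.

Let s1 := eval inp sort_vertices s0.
Let s2 := eval inp weights s1.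

(** The matrix in topological order. Being 0 outside the range, it satisfies [x < y < n] at every
    positive entry, for arbitrary numbers [x] and [y]. *)
Let A x y := if (x < n) && (y < n) then inp (arr s1 aord x * n + arr s1 aord y) else 0.

Lemma ready_weights : ready inp n k l A s2.
Proof.
have n0 : reg s0 rn = n by [].
have [mulE ord_lt _ _] := sort_verticesP n0 (fun=> erefl) input_source.
have [n1 k1 l1] : [/\ reg s1 rn = n, reg s1 rk = k & reg s1 rl = l].
  by split; rewrite /s1 frame_reg.
have [w1 w2 w3 w4] := weightsP inp n1 k1 l1.
split=> //; first by split; rewrite /s2 frame_reg.
rewrite -/s1 in mulE ord_lt.
have ord2 : arr s2 aord = arr s1 aord by rewrite /s2 frame_arr.
have mul2 : arr s2 amul = arr s1 amul by rewrite /s2 frame_arr.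
by move=> x y xn yn; rewrite ord2 mul2 mulE ?ord_lt // /A xn yn.
Qed.

Lemma eval_body : reg (eval inp body s0) racc != 0 <-> contains_subdivision G (spindle k l).
Proof.
rewrite /body eval_seq -/s1 eval_seq -/s2.
have n0 : reg s0 rn = n by [].
have [_ ord_lt ord_inj ord_sorted] := sort_verticesP n0 (fun=> erefl) input_source.
rewrite -/s1 in ord_lt ord_inj ord_sorted.
have A_lt x y : 0 < A x y -> x < y < n.
  by rewrite /A; case: andP => // -[xn yn] /(ord_sorted _ _ xn yn) ->.
pose g (i : 'I_n) := f (Ordinal (ord_lt i (ltn_ord i))).
have g_inj : injective g.
  by move=> i j /(bij_inj f_bij)/(congr1 val)/= /ord_inj e; apply: val_inj; apply: e.
have g_bij : bijective g.
  by apply: (inj_card_bij g_inj); rewrite (bij_eq_card f_bij).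
have A_mult (i j : 'I_n) : A i j = multiplicity (g i) (g j).
  by rewrite /A !ltn_ord -nth_adjacency_matrix.
have [n_eq0|n_gt0] := posnP n.
  split=> [|/contains_subdivision_embeds[s /(linkage_of_embedding l_gt0)[u _]]].
    have n2 : reg s2 rn = 0 by have [[-> _ _] _ _ _] := ready_weights.
    have -> : eval inp solve s2 = iteri (reg s2 rn)
      (fun j s' => eval inp solve_target (set_reg s' rtarget j)) s2 by [].
    by rewrite n2 /s2 frame_reg // /s1 frame_reg.
  by have [f' _ _] := f_bij; have := ltn_ord (f' u); rewrite [X in _ < X]n_eq0.
rewrite (contains_spindle_routable g_bij k_gt0 l_gt0 A_lt A_mult).
by rewrite (solveP n_gt0 k_gt0 l_gt0 A_lt ready_weights) ?frame_reg.
Qed.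

Lemma eval_main : reg (eval inp main s0) rn != 0 <-> contains_subdivision G (spindle k l).
Proof.
rewrite /main eval_seq eval_assign eval_if.
have -> t : reg (set_reg t rn (expr_eval inp t (Var racc))) rn = reg t racc by [].
rewrite [expr_eval _ _ (Var _)]/= [expr_eval _ _ (Num _)]/=.
case: ltnP => n2; last exact: eval_body.
split=> [//|/contains_subdivision_embeds[s /(linkage_of_embedding l_gt0)]].
move=> [u [v [_ [/eqP neq_uv _]]]]; case: neq_uv.
have [f' _ Kf] := f_bij; rewrite -[u]Kf -[v]Kf; congr f; apply: val_inj => /=.
by have := ltn_ord (f' u); have := ltn_ord (f' v); lia.
Qed.

(** The phases are bounded separately because [weights] assigns [rtotal], which then bounds a loop
    of [solve]; only from there on is its value fixed. *)
Lemma time_body : time inp body s0 <=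
  cost (nth 0 [:: n; k; l]) sort_vertices + (cost (nth 0 [:: n; k; l]) weights +
  cost (fun r => if r == rtotal then (n * l) ^ k else nth 0 [:: n; k; l] r) solve).
Proof.
have [_ _ _ [_ _ N2]] := ready_weights.
rewrite /body 2!time_seq -/s1 -/s2; apply: leq_add; last apply: leq_add.
- exact: time_cost.
- by apply: time_cost => // b hb; rewrite frame_reg //; move: b hb; apply/allP.
have fixed : all (fun b => (b == rtotal) ||
    (b \notin assigned weights) && (b \notin assigned sort_vertices)) (bounds solve) by [].
apply: time_cost => // b /(allP fixed) /orP[/eqP ->|/andP[hw hs]]; first exact: N2.
rewrite ifF; last by apply: contraNF hw => /eqP ->.
by rewrite /s2 frame_reg // /s1 frame_reg.
Qed.

Lemma time_main : 0 < n ->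
  1 + 3 * maxn 1 n + time inp main s0 <= 1000 * (l ^ k * n ^ (2 * k + 1)).
Proof.
move=> n_gt0.
have [n1|n_gt1] := leqP n 1.
  have n1' : n = 1 by lia.
  rewrite /main time_seq time_if time_assign [expr_eval _ _ (Var _)]/= [expr_eval _ _ (Num _)]/=.
  rewrite ltnS n1 n1' exp1n muln1 /=; have : 0 < l ^ k by rewrite expn_gt0 l_gt0.
  lia.
pose N := (n * l) ^ k.
have time_le : time inp main s0 <= time inp body s0 + 6.
  rewrite /main time_seq time_if time_assign [expr_eval _ _ (Var _)]/= [expr_eval _ _ (Num _)]/=.
  by rewrite ltnNge n_gt1; move: (time inp body s0) => T; rewrite /=; lia.
(* The factors count targets, states, moves per state, and tokens inspected per move. *)
apply: leq_trans (_ : 1000 * (n * N * n * k) <= _); last first.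
  rewrite leq_mul2l /= /N expnMn.
  have -> : 2 * k + 1 = 2 + k + k.-1 by lia.
  have hk : k <= n ^ k.-1 by rewrite -{1}(prednK k_gt0); apply: ltn_expl.
  rewrite !expnD -mulnn; move: (n ^ k) (l ^ k) (n ^ k.-1) hk => Y L X hk.
  rewrite (_ : L * _ = n * n * Y * L * X); last by lia.
  rewrite (_ : _ * k = n * n * Y * L * k); last by lia.
  by rewrite leq_mul2l hk orbT.
have nl_N : n * l <= N by rewrite -{1}[n * l]expn1 leq_pexp2l // muln_gt0 n_gt0.
apply: leq_trans (leq_add (leqnn _) (leq_trans time_le (leq_add time_body (leqnn _)))) _.
rewrite -/N /=.
have n_N : n <= N by apply: leq_trans nl_N; rewrite leq_pmulr.
have l_N : l <= N by apply: leq_trans nl_N; rewrite leq_pmull.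
have N_gt0 : 0 < N by apply: leq_trans n_N.
move: {time_le nl_N} N n_N l_N N_gt0 => N n_N l_N N_gt0.
set P := n * N * n * k.
(* Each product of loop bounds in the cost is compared with [P]: sorting gives [n * n * n], the
   weights give [l * k] and [n * k], the search the rest. The constant 1000 only has to dominate the
   resulting coefficients, which [lia] checks. *)
have P_nNn : n * N * n <= P by rewrite leq_pmulr.
have P_nNk : n * N * k <= P by rewrite leq_mul2r leq_pmulr ?orbT.
have P_nN : n * N <= P by apply: leq_trans P_nNn; rewrite leq_pmulr.
have P_nk : n * k <= P by apply: leq_trans P_nNk; rewrite leq_mul2r leq_pmulr ?orbT.
have P_lk : l * k <= P by apply: leq_trans P_nNk; rewrite leq_mul2r (leq_trans l_N) ?orbT ?leq_pmull.
have P_k : k <= P by apply: leq_trans P_nk; rewrite leq_pmull.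
have P_nnn : n * n * n <= P by apply: leq_trans P_nNn; rewrite leq_mul2r leq_mul2l n_N !orbT.
have P_nn : n * n <= P by apply: leq_trans P_nnn; rewrite leq_pmulr.
have P_n : n <= P by apply: leq_trans P_nn; rewrite leq_pmulr.
have P_1 : 0 < P by apply: leq_trans P_n.
rewrite /P in P_nNn P_nNk P_nN P_nk P_lk P_k P_nnn P_nn P_n P_1 *; clear -P_nNn P_nNk P_nN P_nk P_lk P_k P_nnn P_nn P_n P_1.
lia.
Qed.

End Main.

Theorem theorem4 :
  exists (p : program) (C : nat),
    forall (n k l : nat) (G : digraph) (f : 'I_n -> vertices G),
      bijective f -> acyclic G -> 0 < k -> 0 < l ->
      exists t : nat,
        let s := run p t (initial [:: n; k; l] (adjacency_matrix f)) in
        [/\ halted p s,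
            accepting s <-> contains_subdivision G (spindle k l) &
            0 < n -> t <= C * (l ^ k * n ^ (2 * k + 1))].
Proof.
exists (compile main), 1000 => n k l G f f_bij acyc k_gt0 l_gt0.
have [] := @run_compile main n [:: n; k; l] (adjacency_matrix f) isT isT erefl (size_adjacency_matrix f).
set t := _ + _ => halt acc; exists t; split=> //; last exact: time_main.
by rewrite /accepting acc; apply: eval_main.
Qed.
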